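(* Let $(M,F)$ be an $n$-dimensional complex Finsler space. The following assertions are equivalent: i) $(M,F)$ is a $G$-Landsberg space; ii) $\overset{B}{L}{}^i_{jk}=\overset{c}{L}{}^i_{jk}$ and these functions depend only on $z$; iii) $C_{l\bar rh\overset{B}{|}0}=0$ and $C_{j\bar 0h\overset{B}{|}\bar 0}=0$; iv) $g_{i\bar j\overset{B}{|}k}=\overset{c}{L}{}^{\bar m}_{\bar jk}g_{i\bar m}$ and $\dot\partial_{\bar h}G^i=0$; v) $C_{j\bar rh\overset{B}{|}k}+C_{k\bar rh\overset{B}{|}j}=0$ and $C_{r\bar lh\overset{B}{|}\bar k}+C_{r\bar kh\overset{B}{|}\bar l}=0$. (All identities are required for all values of the free indices and at all points of $\widetilde{T'M}$.)
   Context: Let $M$ be an $n$-dimensional complex manifold, $T'M$ its holomorphic tangent bundle with local coordinates $(z^k,\eta^k)$, and $\widetilde{T'M}=T'M\setminus\{0\}$ (zero section removed). A complex Finsler space $(M,F)$ is given by a continuous $F:T'M\to[0,\infty)$ with: $L:=F^2$ smooth on $\widetilde{T'M}$; $F(z,\eta)=0$ iff $\eta=0$; $F(z,\lambda\eta)=|\lambda|F(z,\eta)$ for $\lambda\in\mathbb C$; and the Hermitian matrix $g_{i\bar j}:=\partial^2L/\partial\eta^i\partial\bar\eta^j$ positive definite. $(g^{\bar j i})$ is the inverse matrix, $g^{\bar j i}g_{k\bar j}=\delta^i_k$. Notation: $\dot\partial_k=\partial/\partial\eta^k$, $\dot\partial_{\bar k}=\partial/\partial\bar\eta^k$; summation convention.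 Cartan tensors: $C_{i\bar jk}=\dot\partial_kg_{i\bar j}$, $C_{i\bar j\bar k}=\dot\partial_{\bar k}g_{i\bar j}$. Set $N^i_j:=g^{\bar mi}\frac{\partial g_{l\bar m}}{\partial z^j}\eta^l$, spray coefficients $G^i:=\tfrac12N^i_j\eta^j$, $\overset{c}{N}{}^i_j:=\dot\partial_jG^i$, $\overset{c}{\delta}_k:=\frac{\partial}{\partial z^k}-\overset{c}{N}{}^j_k\dot\partial_j$, and $\overset{c}{\delta}_{\bar k}$ its conjugate. Berwald coefficients: $\overset{B}{L}{}^i_{jk}:=\dot\partial_k\overset{c}{N}{}^i_j$, $\overset{B}{L}{}^i_{j\bar k}:=\dot\partial_{\bar k}\overset{c}{N}{}^i_j$. Rund coefficients: $\overset{c}{L}{}^i_{jk}:=\tfrac12g^{\bar li}(\overset{c}{\delta}_kg_{j\bar l}+\overset{c}{\delta}_jg_{k\bar l})$, $\overset{c}{L}{}^i_{j\bar k}:=\tfrac12g^{\bar li}(\overset{c}{\delta}_{\bar k}g_{j\bar l}-\overset{c}{\delta}_{\bar l}g_{j\bar k})$. Barred-index coefficients are conjugates: $L^{\bar\imath}_{\bar jk}=\overline{L^i_{j\bar k}}$, $L^{\bar\imath}_{\bar j\bar k}=\overline{L^i_{jk}}$. The $h$-covariant derivative with respect to the Berwald connection, $\overset{B}{|}k$, of a tensor with lower indices applies $\overset{c}{\delta}_k$ and subtracts a term $\overset{B}{L}{}^l_{ik}$ for each unbarred lower index $i$ and $\overset{B}{L}{}^{\bar m}_{\bar jk}$ for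 each barred lower index $\bar j$; e.g. $g_{i\bar j\overset{B}{|}k}=\overset{c}{\delta}_kg_{i\bar j}-\overset{B}{L}{}^l_{ik}g_{l\bar j}-\overset{B}{L}{}^{\bar m}_{\bar jk}g_{i\bar m}$. The $\bar h$-covariant derivative $\overset{B}{|}\bar k$ similarly uses $\overset{c}{\delta}_{\bar k}$, $\overset{B}{L}{}^l_{i\bar k}$ and $\overset{B}{L}{}^{\bar m}_{\bar j\bar k}$. An index $0$ (resp. $\bar 0$) means contraction with $\eta$ (resp. $\bar\eta$): $C_{l\bar rh\overset{B}{|}0}=C_{l\bar rh\overset{B}{|}k}\eta^k$, $C_{j\bar 0h\overset{B}{|}\bar 0}=C_{j\bar rh\overset{B}{|}\bar k}\bar\eta^r\bar\eta^k$. $(M,F)$ is a complex Landsberg space if $\overset{B}{L}{}^i_{jk}=\overset{c}{L}{}^i_{jk}$. It is $G$-Landsberg if it is complex Landsberg and the spray coefficients are holomorphic in $\eta$, i.e. $\dot\partial_{\bar k}G^i=0$. *)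

(* Defs.v *)
From HB Require Import structures.
From mathcomp Require Import all_boot all_order all_algebra.
From mathcomp Require Import complex.
From mathcomp Require Import all_classical all_reals all_analysis.

Set Implicit Arguments.
Unset Strict Implicit.
Unset Printing Implicit Defensive.

Import Order.TTheory GRing.Theory Num.Theory.
Import numFieldNormedType.Exports.

Local Open Scope classical_set_scope.
Local Open Scope ring_scope.

(* R[i], typed so that the topology of an abstract numClosedFieldType applies
   to it. *)
Definition Cplx (R : realType) : numClosedFieldType := R[i].

Section RealCalculus.
Variables (R : realType) (V : normedModType (Cplx R)).
Local Notation C := (Cplx R).
Implicit Types (f : V -> C) (v x : V) (A : set V).

(* The derivative along v is taken over the reals (the library derivative
   'D_v f is complex-linear in v here, since the scalars of V are complex),
   separately on the real and on the imaginary part of f. *)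
Definition re_line f v x (t : R) : R := complex.Re (f (x + (t%:C)%C *: v)).
Definition im_line f v x (t : R) : R := complex.Im (f (x + (t%:C)%C *: v)).

Definition rderivable f v x : Prop :=
  derivable (re_line f v x) 0 1 /\ derivable (im_line f v x) 0 1.

Definition rderive f v x : C :=
  Complex (derive1 (re_line f v x) 0) (derive1 (im_line f v x) 0).

(* Real differentiability class C^k on an open set: all iterated directional
   derivatives of order at most k exist and are continuous. *)
Fixpoint class_C A (k : nat) f : Prop :=
  {in A, continuous f} /\
  if k is k'.+1 then
    (forall v x, A x -> rderivable f v x) /\
    (forall v, class_C A k' (rderive f v))
  else True.

Definition smooth_on A f : Prop := forall k, class_C A k f.

(* If w is the real coordinate zeta = xi + i y with unit vector v, then 'i *: v
   is the direction of y, and these are d/d zeta and d/d zetabar. *)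
Definition wirtinger v f : V -> C := fun x =>
  2^-1 * (rderive f v x - 'i * rderive f ('i *: v) x).
Definition wirtinger_bar v f : V -> C := fun x =>
  2^-1 * (rderive f v x + 'i * rderive f ('i *: v) x).

End RealCalculus.

Record complexManifold (R : realType) (n : nat) := ComplexManifold {
  points :> topologicalType ;
  points_hausdorff : hausdorff_space points ;
  points_second_countable : @second_countable points ;
  chart_index : Type ;
  chart_dom : chart_index -> set points ;
  chart : chart_index -> points -> 'rV[Cplx R]_n ;
  chart_inv : chart_index -> 'rV[Cplx R]_n -> points ;
  chart_cover : \bigcup_a chart_dom a = setT ;
  chart_dom_open : forall a, open (chart_dom a) ;
  chart_image_open : forall a, open (chart a @` chart_dom a) ;
  chartK : forall a, {in chart_dom a, cancel (chart a) (chart_inv a)} ;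
  chart_continuous : forall a, {in chart_dom a, continuous (chart a)} ;
  chart_inv_continuous : forall a,
    {in chart a @` chart_dom a, continuous (chart_inv a)} ;
  (* complex differentiability, the scalars being complex *)
  transition_holomorphic : forall a b,
    forall z, (chart a @` (chart_dom a `&` chart_dom b)) z ->
    differentiable (chart b \o chart_inv a) z
}.

Arguments chart_index {R n} M : rename.
Arguments chart_dom {R n M} a : rename.
Arguments chart {R n M} a : rename.
Arguments chart_inv {R n M} a : rename.

Section TangentBundle.
Variables (R : realType) (n : nat) (M : complexManifold R n).
Local Notation C := (Cplx R).

(* T'M is obtained by gluing the sets tangent_dom a along
   (z, eta) ~ tangent_transition a b (z, eta) over the overlaps of charts. *)
Definition transition (a b : chart_index M) : 'rV[C]_n -> 'rV[C]_n :=
  chart b \o chart_inv a.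

Definition tangent_dom (a : chart_index M) : set ('rV[C]_n * 'rV[C]_n) :=
  [set x | (chart a @` chart_dom a) x.1].

Definition slit_tangent_dom (a : chart_index M) : set ('rV[C]_n * 'rV[C]_n) :=
  [set x | tangent_dom a x /\ x.2 != 0].

Definition tangent_transition (a b : chart_index M)
    (x : 'rV[C]_n * 'rV[C]_n) : 'rV[C]_n * 'rV[C]_n :=
  (transition a b x.1, 'd (transition a b) (x.1) x.2).

End TangentBundle.

(* The local geometric objects in coordinates x = (z, eta), as functions of the
   local expression L of F^2.  Indices written as barred in the mathematics are
   ordinary indices here, in the same position. *)
Section LocalObjects.
Variables (R : realType) (n : nat).
Local Notation C := (Cplx R).
Local Notation V := ('rV[C]_n * 'rV[C]_n)%type.

Definition dz (k : 'I_n) : (V -> C) -> V -> C := wirtinger (delta_mx 0 k, 0).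
Definition dzbar (k : 'I_n) : (V -> C) -> V -> C :=
  wirtinger_bar (delta_mx 0 k, 0).
Definition deta (k : 'I_n) : (V -> C) -> V -> C := wirtinger (0, delta_mx 0 k).
Definition detabar (k : 'I_n) : (V -> C) -> V -> C :=
  wirtinger_bar (0, delta_mx 0 k).

Variable L : V -> C.
Implicit Types (i j k l h m r : 'I_n) (x : V).

(* g_{i jbar} *)
Definition metric i j : V -> C := deta i (detabar j L).

Definition metric_mx x : 'M[C]_n := \matrix_(i, j) metric i j x.

(* g^{jbar i} *)
Definition metric_inv j i x : C := invmx (metric_mx x) j i.

(* C_{i jbar k} *)
Definition cartan i j k : V -> C := deta k (metric i j).

(* N^i_j *)
Definition cfN i j x : C :=
  \sum_m \sum_l metric_inv m i x * dz j (metric l m) x * x.2 0 l.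

Definition spray i x : C := 2^-1 * \sum_j cfN i j x * x.2 0 j.

(* the connection induced by the spray: \overset{c}{N}^i_j *)
Definition cN i j : V -> C := deta j (spray i).

Definition delta k (f : V -> C) x : C :=
  dz k f x - \sum_j cN j k x * deta j f x.
Definition deltabar k (f : V -> C) x : C :=
  dzbar k f x - \sum_j (cN j k x)^* * detabar j f x.

(* L^i_{jk} and L^i_{j kbar} of the Berwald connection *)
Definition berwald i j k : V -> C := deta k (cN i j).
Definition berwald_bar i j k : V -> C := detabar k (cN i j).

(* L^i_{jk} and L^i_{j kbar} of the Rund connection *)
Definition rund i j k x : C :=
  2^-1 * \sum_l metric_inv l i x *
    (delta k (metric j l) x + delta j (metric k l) x).
Definition rund_bar i j k x : C :=
  2^-1 * \sum_l metric_inv l i x *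
    (deltabar k (metric j l) x - deltabar l (metric j k) x).

(* Berwald h- and hbar-covariant derivatives of tensors T_{i jbar} and
   T_{i jbar h}; the last index is the direction of differentiation. *)
Definition hcov2 (T : 'I_n -> 'I_n -> V -> C) i j k x : C :=
  delta k (T i j) x
  - \sum_l berwald l i k x * T l j x
  - \sum_m (berwald_bar m j k x)^* * T i m x.

Definition hcov3 (T : 'I_n -> 'I_n -> 'I_n -> V -> C) i j h k x : C :=
  delta k (T i j h) x
  - \sum_l berwald l i k x * T l j h x
  - \sum_m (berwald_bar m j k x)^* * T i m h x
  - \sum_l berwald l h k x * T i j l x.

Definition hbarcov3 (T : 'I_n -> 'I_n -> 'I_n -> V -> C) i j h k x : C :=
  deltabar k (T i j h) x
  - \sum_l berwald_bar l i k x * T l j h x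
  - \sum_m (berwald m j k x)^* * T i m h x
  - \sum_l berwald_bar l h k x * T i j l x.

End LocalObjects.

(* F : T'M -> [0, +oo[ is given by its expressions in the charts, which agree
   under the changes of coordinates of T'M. *)
Record complexFinsler (R : realType) (n : nat) (M : complexManifold R n) :=
  ComplexFinsler {
  finsler : chart_index M -> 'rV[Cplx R]_n * 'rV[Cplx R]_n -> R ;
  finsler_glue : forall a b x,
    (chart a @` (chart_dom a `&` chart_dom b)) x.1 ->
    finsler b (tangent_transition a b x) = finsler a x ;
  finsler_ge0 : forall a x, tangent_dom a x -> 0 <= finsler a x ;
  finsler_continuous : forall a, {in tangent_dom a, continuous (finsler a)} ;
  finsler_smooth : forall a,
    smooth_on (slit_tangent_dom a)
      (fun x => ((finsler a x ^+ 2)%:C)%C : Cplx R) ;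
  finsler_eq0 : forall a x, tangent_dom a x ->
    (finsler a x = 0 <-> x.2 = 0) ;
  finsler_homogeneous : forall a z eta (lambda : Cplx R),
    tangent_dom a (z, eta) ->
    ((finsler a (z, lambda *: eta))%:C)%C
      = `|lambda| * ((finsler a (z, eta))%:C)%C :> Cplx R ;
  finsler_pos_def : forall a x, slit_tangent_dom a x ->
    forall v : 'rV[Cplx R]_n, v != 0 ->
    0 < \sum_i \sum_j
          metric (fun y => ((finsler a y ^+ 2)%:C)%C) i j x * v 0 i * (v 0 j)^*
}.

(* L = F^2 in the chart a *)
Definition finsler_L (R : realType) (n : nat) (M : complexManifold R n)
    (F : complexFinsler M) (a : chart_index M) :
    'rV[Cplx R]_n * 'rV[Cplx R]_n -> Cplx R :=
  fun x => ((finsler F a x ^+ 2)%:C)%C.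

Section Landsberg.
Variables (R : realType) (n : nat) (M : complexManifold R n).
Variable F : complexFinsler M.

Definition complex_landsberg : Prop :=
  forall a x, slit_tangent_dom a x -> forall i j k,
    berwald (finsler_L F a) i j k x = rund (finsler_L F a) i j k x.

Definition spray_holomorphic : Prop :=
  forall a x, slit_tangent_dom a x -> forall i k,
    detabar k (spray (finsler_L F a) i) x = 0.

Definition G_landsberg : Prop := complex_landsberg /\ spray_holomorphic.

Definition berwald_depends_only_on_z : Prop :=
  forall a z eta eta',
    slit_tangent_dom a (z, eta) -> slit_tangent_dom a (z, eta') ->
    forall i j k,
    berwald (finsler_L F a) i j k (z, eta)
      = berwald (finsler_L F a) i j k (z, eta').

End Landsberg.

(* Main.v *)
Require Import Defs.
From HB Require Import structures.
From mathcomp Require Import all_boot all_order all_algebra.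
From mathcomp Require Import perm complex ring lra.
From mathcomp Require Import all_classical all_reals all_analysis.

Set Implicit Arguments.
Unset Strict Implicit.
Unset Printing Implicit Defensive.

Import Order.TTheory GRing.Theory Num.Theory.
Import numFieldNormedType.Exports.

Local Open Scope classical_set_scope.
Local Open Scope ring_scope.

(* Put L = F^2.  In each chart the spray is determined by
     2 g_{i mbar} G^i = eta^j d_{z^j} d_{mbar} L.
   Differentiating this along conj(eta^h), respectively along eta^k and eta^h,
   and using the Euler relations of L, g, G and N, one finds
     C_{j 0bar h | 0bar} = 2 g_{j ibar} conj(d_{hbar} G^i),
     C_{k mbar h | 0} = 2 g_{i mbar} (B^i_{kh} - L^i_{kh}),
   B being the Berwald and L the Rund coefficients, so that iii) says exactly
   that G is holomorphic along the fibres and B = L.  When G is holomorphic, iv)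
   is the lowered form of B = L, and the B^i_{kh} are holomorphic and homogeneous
   of degree 0 in eta: they are bounded on every complex line of the fibre that
   misses the origin, hence constant along the fibres by Liouville's theorem.
   Then v) is the derivative of the lowered Landsberg identity and of its
   conjugate along eta^h, and contracting v) with eta gives back iii). *)

(** * Real functions of two variables *)

(** Smoothness is given by iterated real derivatives along fixed vectors, so linearity of the
    derivative in its direction and symmetry of second derivatives have to be proved: both follow
    from the mean value theorem on the real plane spanned by two directions. The Wirtinger
    derivatives are then commuting derivations, and the tensor identities become algebra over
    abstract derivations of this kind. The boundedness behind Liouville's theorem comes from
    homogeneity: if the line [e + c w] misses the origin, a function of degree 0 satisfies f(e + c
    w) = f(w + c^-1 e), so its values for large c are those near w. If the line joining two points
    of a fibre meets the origin, the points are proportional and homogeneity alone compares them. A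
    bounded harmonic function on the plane never exceeds its value at the centre; used from each of
    the two points, this gives equality of real parts. From ii) back to holomorphy of G one uses 2
    G^i = B^i_{jk} eta^j eta^k, the Euler relations applied twice. *)

Section RealCalculusLemmas.
Variable R : realType.
Implicit Types (f df : R -> R) (P Q : R -> R -> R).

Lemma is_derive_continuous f (x d : R) :
  is_derive x 1 f d -> {for x, continuous f}.
Proof.
by move=> fd; apply/differentiable_continuous/derivable1_diffP/ex_derive.
Qed.

Lemma mean_value f df (a b : R) : a < b ->
  (forall x, a <= x <= b -> is_derive x 1 f (df x)) ->
  exists c, a < c < b /\ f b - f a = df c * (b - a).
Proof.
move=> ab fd.
have fd' x : x \in `]a, b[ -> is_derive x 1 f (df x).
  by rewrite in_itv /= => /andP[/ltW ax /ltW xb]; apply: fd; rewrite ax.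
have [|c] := MVT ab fd'.
  apply: continuous_in_subspaceT => x; rewrite inE /= in_itv /= => xh.
  exact: is_derive_continuous (fd x xh).
by rewrite in_itv /= => ch ->; exists c.
Qed.

Lemma mean_value_0 f df (h : R) : 0 < h ->
  (forall x, 0 <= x <= h -> is_derive x 1 f (df x)) ->
  exists c, 0 < c < h /\ f h - f 0 = df c * h.
Proof. by move=> h0 /(mean_value h0); rewrite subr0. Qed.

Lemma continuous2_eps P : {for (0, 0), continuous (fun p : R * R => P p.1 p.2)} ->
  forall e, 0 < e -> exists2 d, 0 < d &
    forall s t : R, `|s| < d -> `|t| < d -> `|P s t - P 0 0| < e.
Proof.
move=> /cvgrPdist_lt cP e e0.
have /nbhs_ballP[d /= d0 dP] := cP e e0; exists d => // s t sd td.
rewrite distrC; apply: (dP (s, t)); split => /=;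
  by rewrite /ball /= sub0r normrN.
Qed.

(** The mean value theorem is applied twice: to the increment of [P] in the second variable, as a
    function of the first, and then to [Ps a]. *)
Lemma mixed_difference (P Ps Pst : R -> R -> R) (d : R) :
  (forall s t : R, `|s| < d -> `|t| < d -> is_derive s 1 (P ^~ t) (Ps s t)) ->
  (forall s t : R, `|s| < d -> `|t| < d -> is_derive t 1 (Ps s) (Pst s t)) ->
  forall h, 0 < h < d -> exists a b, [/\ 0 < a < h, 0 < b < h &
    P h h - P 0 h - (P h 0 - P 0 0) = Pst a b * h * h].
Proof.
move=> dP dPs h /andP[h0 hd].
have small x : 0 <= x <= h -> `|x| < d.
  by move=> /andP[x0 xh]; rewrite ger0_norm// (le_lt_trans xh).
have hs : `|h| < d by rewrite small// lexx ltW.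
have zs : `|0 : R| < d by rewrite small// lexx ltW.
have [a [ah E]] := @mean_value_0 (fun s => P s h - P s 0)
  (fun s => Ps s h - Ps s 0) h h0 (fun x xh => is_deriveB
     (dP x h (small x xh) hs) (dP x 0 (small x xh) zs)).
have ad : `|a| < d by apply: small; case/andP: ah => /ltW -> /ltW ->.
have [b [bh Eb]] := @mean_value_0 (Ps a) (Pst a) h h0
  (fun x xh => dPs a x ad (small x xh)).
exists a, b; split => //; rewrite -Eb -E; ring.
Qed.

(** Both mixed derivatives, each at some point of the square of side [h], equal the same second
    difference divided by [h * h]; continuity at the origin lets [h] shrink. *)
Lemma mixed_derivatives_eq (P Ps Pt Pst Pts : R -> R -> R) (d : R) : 0 < d ->
  (forall s t : R, `|s| < d -> `|t| < d -> is_derive s 1 (P ^~ t) (Ps s t)) ->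
  (forall s t : R, `|s| < d -> `|t| < d -> is_derive t 1 (Ps s) (Pst s t)) ->
  (forall s t : R, `|s| < d -> `|t| < d -> is_derive t 1 (P s) (Pt s t)) ->
  (forall s t : R, `|s| < d -> `|t| < d -> is_derive s 1 (Pt ^~ t) (Pts s t)) ->
  {for (0, 0), continuous (fun p => Pst p.1 p.2)} ->
  {for (0, 0), continuous (fun p => Pts p.1 p.2)} ->
  Pst 0 0 = Pts 0 0.
Proof.
move=> d0 dPs dPst dPt dPts /continuous2_eps cst /continuous2_eps cts.
apply/eqP; rewrite -subr_eq0 -normr_le0; apply/ler_addgt0Pr => e e0.
have e20 : 0 < e / 2 by rewrite divr_gt0.
have [d1 d10 H1] := cst _ e20; have [d2 d20 H2] := cts _ e20.
pose h := Num.min d (Num.min d1 d2) / 2.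
have m0 : 0 < Num.min d (Num.min d1 d2) by rewrite !lt_min d0 d10.
have h0 : 0 < h by rewrite divr_gt0.
have : h < Num.min d (Num.min d1 d2) by rewrite /h; lra.
rewrite !lt_min => /and3P[hd hd1 hd2].
have hh : 0 < h < d by rewrite h0.
have [a [b [ah bh E1]]] := mixed_difference dPs dPst hh.
have [a' [b' [ah' bh' E2]]] := @mixed_difference (fun s t => P t s)
  (fun s t => Pt t s) (fun s t => Pts t s) d (fun s t sd td => dPt t s td sd)
  (fun s t sd td => dPts t s td sd) h hh.
have E : Pst a b = Pts b' a'.
  apply: (mulIf (lt0r_neq0 h0)); apply: (mulIf (lt0r_neq0 h0)).
  rewrite -E1 -E2; ring.
have nrm (x D : R) : 0 < x < h -> h < D -> `|x| < D.
  by move=> /andP[x0 xh] hD; rewrite ger0_norm ?ltW// (lt_trans xh).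
have := H1 a b (nrm _ _ ah hd1) (nrm _ _ bh hd1).
have := H2 b' a' (nrm _ _ bh' hd2) (nrm _ _ ah' hd2).
rewrite E add0r => K1 K2.
have -> : Pst 0 0 - Pts 0 0 =
  (Pts b' a' - Pts 0 0) - (Pts b' a' - Pst 0 0) by ring.
apply: (le_trans (ler_normB _ _)); lra.
Qed.

(** The diagonal increment splits into an increment in [s] at height [h] and one in [t] at [s = 0].
    This is the source of additivity of a directional derivative in its direction. *)
Lemma derivative_diagonal (P Ps Pt : R -> R -> R) (Pd : R -> R) (d : R) : 0 < d ->
  (forall s t : R, `|s| < d -> `|t| < d -> is_derive s 1 (P ^~ t) (Ps s t)) ->
  (forall s t : R, `|s| < d -> `|t| < d -> is_derive t 1 (P s) (Pt s t)) ->
  (forall t : R, `|t| < d -> is_derive t 1 (fun t => P t t) (Pd t)) ->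
  {for (0, 0), continuous (fun p => Ps p.1 p.2)} ->
  {for (0, 0), continuous (fun p => Pt p.1 p.2)} ->
  {for (0, 0), continuous (fun p : R * R => Pd p.1)} ->
  Pd 0 = Ps 0 0 + Pt 0 0.
Proof.
move=> d0 dPs dPt dPd /continuous2_eps cs /continuous2_eps ct.
move=> cd0; have cd := @continuous2_eps (fun s _ => Pd s) cd0.
apply/eqP; rewrite -subr_eq0 -normr_le0; apply/ler_addgt0Pr => e e0.
have e30 : 0 < e / 3 by rewrite divr_gt0.
have [d1 d10 H1] := cs _ e30; have [d2 d20 H2] := ct _ e30.
have [d3 d30 H3] := cd _ e30.
pose m := Num.min (Num.min d d3) (Num.min d1 d2).
have m0 : 0 < m by rewrite !lt_min d0 d10 d20 d30.
pose h := m / 2.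
have h0 : 0 < h by rewrite divr_gt0.
have : h < m by rewrite /h; lra.
rewrite !lt_min => /andP[/andP[hd hd3] /andP[hd1 hd2]].
have small x : 0 <= x <= h -> `|x| < d.
  by move=> /andP[x0 xh]; rewrite ger0_norm// (le_lt_trans xh).
have hs : `|h| < d by rewrite ger0_norm// ltW.
have zs : `|0 : R| < d by rewrite normr0.
have [a [ah Ea]] := @mean_value_0 (P ^~ h) (Ps ^~ h) h h0
  (fun x xh => dPs x h (small x xh) hs).
have [b [bh Eb]] := @mean_value_0 (P 0) (Pt 0) h h0
  (fun x xh => dPt 0 x zs (small x xh)).
have [c [ch Ec]] := @mean_value_0 (fun t => P t t) Pd h h0
  (fun x xh => dPd x (small x xh)).
have E : Pd c = Ps a h + Pt 0 b.
  apply: (mulIf (lt0r_neq0 h0)); rewrite -Ec mulrDl -Ea -Eb; ring.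
have nrm (x D : R) : 0 < x < h -> h < D -> `|x| < D.
  by move=> /andP[x0 xh] hD; rewrite ger0_norm ?ltW// (lt_trans xh).
have hn D : h < D -> `|h| < D by rewrite ger0_norm// ltW.
have zn D : 0 < D -> `|0 : R| < D by rewrite normr0.
have := H1 a h (nrm _ _ ah hd1) (hn _ hd1).
have := H2 0 b (zn _ d20) (nrm _ _ bh hd2).
have := H3 c 0 (nrm _ _ ch hd3) (zn _ d30).
rewrite E add0r => K3 K2 K1.
have -> : Pd 0 - (Ps 0 0 + Pt 0 0) =
  (Ps a h - Ps 0 0) + (Pt 0 b - Pt 0 0) - (Ps a h + Pt 0 b - Pd 0) by ring.
apply: (le_trans (ler_normB _ _)).
have := ler_normD (Ps a h - Ps 0 0) (Pt 0 b - Pt 0 0); lra.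
Qed.

(** If [d2] were positive, [df], which vanishes at the maximum, would be positive just to the right
    of [x], and [f] would increase there. *)
Lemma second_derivative_local_max f df (x d2 e : R) : 0 < e ->
  (forall y, `|y - x| < e -> f y <= f x) ->
  (forall y, `|y - x| < e -> is_derive y 1 f (df y)) ->
  is_derive x 1 df d2 -> d2 <= 0.
Proof.
move=> e0 fmax fd dfd.
have near_x y : y \in `](x - e), (x + e)[ -> `|y - x| < e.
  by rewrite in_itv /= => /andP[? ?]; rewrite ltr_norml; lra.
have dfx : df x = 0.
  have xI : x \in `](x - e), (x + e)[ by rewrite in_itv /=; lra.
  have ab : x - e <= x + e by lra.
  have fI y : y \in `](x - e), (x + e)[ -> derivable f y 1.
    by move=> /near_x yI; apply: ex_derive; apply: fd.
  have H := derive1_at_max ab fI xI (fun y yI => fmax y (near_x y yI)).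
  have H' := fd x; rewrite subrr normr0 in H'.
  by have := @derive_val _ _ _ _ _ _ _ (H' e0); rewrite (@derive_val _ _ _ _ _ _ _ H).
rewrite leNgt; apply/negP => d20.
have [dq dE] := dfd.
(* With tolerance [d2] itself, the difference quotients of [df] near [x] stay positive. *)
have /cvgrPdist_lt /(_ _ d20) :
    (fun h => h^-1 *: (df (h *: 1 + x) - df x)) @ 0^' --> d2.
  by rewrite -dE; exact: dq.
rewrite /= => /nbhs_ballP[r /= r0 rP].
pose h := Num.min r e / 2.
have m0 : 0 < Num.min r e by rewrite lt_min r0 e0.
have h0 : 0 < h by rewrite divr_gt0.
have : h < Num.min r e by rewrite /h; lra.
rewrite lt_min => /andP[hr he].
have xxh : x < x + h by rewrite ltrDl.
have fxh t : x <= t <= x + h -> is_derive t 1 f (df t).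
  by move=> /andP[xt th]; apply: fd; rewrite ltr_norml; lra.
have [c [/andP[xc cx] Ec]] := mean_value xxh fxh.
have : 0 < df c.
  have cx0 : 0 < c - x by lra.
  have := rP (c - x); rewrite /ball /= sub0r normrN gtr0_norm//.
  rewrite [_ *: 1]mulr1 subrK dfx subr0 => H.
  have {H} : `|d2 - (c - x)^-1 * df c| < d2.
    by apply: H; [lra|rewrite lt0r_neq0].
  rewrite ltr_norml => /andP[_]; rewrite ltrBlDr ltrDl.
  by rewrite pmulr_rgt0// invr_gt0.
have : f (x + h) <= f x by apply: fmax; rewrite addrC addKr gtr0_norm.
rewrite -subr_le0 Ec addrAC subrr add0r pmulr_lle0// => /le_lt_trans H /H.
by rewrite ltxx.
Qed.

End RealCalculusLemmas.

(** * A maximum principle for bounded harmonic functions on the plane *)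

Section Barrier.
Variable R : realType.
Implicit Types (f df : R -> R) (P Q : R -> R -> R).

Lemma barrier_second_derivative (u du : R -> R) (t0 d2u s e k w : R) : 0 < w ->
  (forall t : R, is_derive t 1 u (du t)) -> is_derive t0 1 du d2u ->
  (forall t : R, `|t - t0| < w -> 0 < t ^+ 2 + s) ->
  (forall t : R, `|t - t0| < w ->
    u t - e * ln (t ^+ 2 + s) + k * (t ^+ 2 + s) <=
    u t0 - e * ln (t0 ^+ 2 + s) + k * (t0 ^+ 2 + s)) ->
  d2u - e * (2 / (t0 ^+ 2 + s) - 4 * t0 ^+ 2 / (t0 ^+ 2 + s) ^+ 2) + 2 * k <= 0.
Proof.
move=> w0 dudt d2udt pos umax.
pose du' t := du t - e * (2 * t / (t ^+ 2 + s)) + k * (2 * t).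
have dq t : is_derive t (1 : R) (fun t => t ^+ 2 + s) (2 * t).
  apply: is_derive_eq; rewrite addr0 [_ *: _]mulr1; ring.
have q0 : 0 < t0 ^+ 2 + s by apply: pos; rewrite subrr normr0.
have dline (v : R -> R) c t dv : is_derive t (1 : R) v dv ->
    is_derive t (1 : R) (fun t => c * v t) (c * dv).
  by move=> dvt; exact: is_deriveZ.
apply: (second_derivative_local_max (df := du') w0 umax) => [t tw|].
  have dl : is_derive t (1 : R) (fun t => ln (t ^+ 2 + s))
      ((t ^+ 2 + s)^-1 * (2 * t)).
    exact: (@is_derive1_comp _ _ _ t _ _ (is_derive1_ln (pos t tw)) (dq t)).
  have := is_deriveD (is_deriveB (dudt t) (dline _ e _ _ dl)) (dline _ k _ _ (dq t)).
  by move=> /is_derive_eq; apply; rewrite /du' [2 * t / _]mulrC.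
have d2 : is_derive t0 (1 : R) (fun t => 2 * t) 2.
  by have := dline id 2 t0 _ (is_derive_id t0 1); rewrite mulr1.
have dV : is_derive t0 (1 : R) (fun t => 2 * t / (t ^+ 2 + s))
    (2 / (t0 ^+ 2 + s) - 4 * t0 ^+ 2 / (t0 ^+ 2 + s) ^+ 2).
  have := is_deriveM d2
    (@is_deriveV _ (fun t => t ^+ 2 + s) t0 _ _ (lt0r_neq0 q0) (dq t0)).
  move=> /is_derive_eq; apply; rewrite /= /GRing.scale /=; field.
  exact: lt0r_neq0.
have := is_deriveD (is_deriveB d2udt (dline _ e _ _ dV)) (dline _ k _ _ d2).
by move=> /is_derive_eq; apply; rewrite [k * 2]mulrC.
Qed.

(* The barrier [eps * ln (x^2 + y^2)] is harmonic off the origin and unbounded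
   at infinity, and [k * (x^2 + y^2)] makes the difference strictly
   subharmonic, so that it has no interior maximum in an annulus. *)
Lemma harmonic_le_center (U Ux Uy Uxx Uyy : R -> R -> R) (B : R) :
  continuous (fun p : R * R => U p.1 p.2) ->
  (forall x y : R, is_derive x 1 (U ^~ y) (Ux x y)) ->
  (forall x y : R, is_derive x 1 (Ux ^~ y) (Uxx x y)) ->
  (forall x y : R, is_derive y 1 (U x) (Uy x y)) ->
  (forall x y : R, is_derive y 1 (Uy x) (Uyy x y)) ->
  (forall x y, Uxx x y + Uyy x y = 0) ->
  (forall x y, U x y <= B) ->
  forall x y, U x y <= U 0 0.
Proof.
move=> cU dUx dUxx dUy dUyy harm Ub x1 y1; rewrite leNgt; apply/negP => U01.
(* The excess to be refuted is [3 * c]: a share [c] covers the variation of [U] near the origin,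
   [c / 2] the logarithm and [c / 2] the quadratic term. *)
pose c := (U x1 y1 - U 0 0) / 3.
have c0 : 0 < c by rewrite /c; lra.
have [d d0 dP] := continuous2_eps (cU (0, 0)) c0.
pose q x y : R := x ^+ 2 + y ^+ 2.
have q_ge0 x y : 0 <= q x y by rewrite addr_ge0 ?sqr_ge0.
have q10 : 0 < q x1 y1.
  rewrite lt0r q_ge0 andbT; apply: contraTneq U01 => /eqP.
  by rewrite paddr_eq0 ?sqr_ge0// !sqrf_eq0 => /andP[/eqP-> /eqP->]; rewrite ltxx.
(* The squared inner radius: inside the disc where [U] varies by less than [c], and closer to the
   origin than [(x1, y1)]. *)
pose d2 := Num.min (d ^+ 2) (q x1 y1) / 2.
have md0 : 0 < Num.min (d ^+ 2) (q x1 y1) by rewrite lt_min exprn_gt0.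
have d20 : 0 < d2 by rewrite divr_gt0.
have : d2 < Num.min (d ^+ 2) (q x1 y1) by rewrite /d2; lra.
rewrite lt_min => /andP[d2d d2q].
have ln_lt : ln d2 < ln (q x1 y1) by rewrite ltr_ln ?posrE.
pose e := c / (ln (q x1 y1) - ln d2) / 2.
have e0 : 0 < e by rewrite !divr_gt0// subr_gt0.
have eE : e * (ln (q x1 y1) - ln d2) = c / 2.
  by rewrite /e; field; rewrite subr_eq0 gt_eqF.
(* Once [ln (q x y)] reaches [T], the barrier outweighs the bound [B]; this fixes the squared outer
   radius [r2]. *)
pose T := (`|B| + `|U 0 0| + e * `|ln d2|) / e.
have T_ge0 : 0 <= T.
  apply: divr_ge0; last exact: ltW.
  by apply: addr_ge0; [exact: addr_ge0|apply: mulr_ge0 => //; exact: ltW].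
pose r2 := q x1 y1 + expR T.
have r2q : q x1 y1 < r2 by rewrite ltrDl expR_gt0.
have r20 : 0 < r2 by rewrite (lt_trans q10).
have Tr2 : T <= ln r2.
  by rewrite -[leLHS]expRK ler_ln ?posrE ?expR_gt0// lerDr ltW.
pose k := c / r2 / 2.
have k0 : 0 < k by rewrite /k divr_gt0// divr_gt0.
have kr2 : k * r2 = c / 2 by rewrite /k; field; rewrite gt_eqF.
pose V (p : R * R) := U p.1 p.2 - e * ln (q p.1 p.2) + k * q p.1 p.2.
pose K := [set p : R * R | d2 <= q p.1 p.2 <= r2].
have cq : continuous (fun p : R * R => q p.1 p.2).
  by move=> p; apply: cvgD; apply: cvgM; (apply: cvg_fst || apply: cvg_snd).
have sqle (x y : R) : q x y <= r2 -> `|x| <= Num.sqrt r2.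
  move=> qr; rewrite -sqrtr_sqr ler_wsqrtr// (le_trans _ qr)// lerDl sqr_ge0.
  by [].
have compactK : compact K.
  pose I := `[- Num.sqrt r2, Num.sqrt r2]%classic.
  apply: (@subclosed_compact _ _ (I `*` I)).
  - have -> : K = (fun p : R * R => q p.1 p.2) @^-1` `[d2, r2].
      by apply/seteqP; split => p /=; rewrite in_itv.
    by apply: preimage_closed; [move=> p _; exact: cq|exact: itv_closed].
  - by apply: compact_setX; exact: segment_compact.
  - move=> p /= /andP[_ pr2]; rewrite /I /= !in_itv /= -!ler_norml.
    by split; [exact: sqle pr2|apply: (sqle _ p.1); rewrite /q addrC].
have cV : {within K, continuous V}.
  apply: continuous_in_subspaceT => p; rewrite inE => /andP[pd2 _].
  have qp : 0 < q p.1 p.2 by exact: lt_le_trans pd2.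
  apply: cvgD; last by apply: cvgM; [exact: cvg_cst|exact: cq].
  apply: cvgB; first exact: cU.
  apply: cvgM; first exact: cvg_cst.
  exact: (continuous_comp (cq p) (continuous_ln qp)).
have K1 : K (x1, y1) by rewrite /K /= !ltW.
have [p pK pmax] := compact_EVT_max (ex_intro _ _ K1) compactK cV.
have V1 : U 0 0 + 2 * c - e * ln d2 < V (x1, y1).
  have -> : V (x1, y1) = U x1 y1 - (c / 2 + e * ln d2) + k * q x1 y1.
    by rewrite /V /= -eE; ring.
  have kq : 0 <= k * q x1 y1 by rewrite mulr_ge0// ltW.
  have : U x1 y1 = U 0 0 + 3 * c by rewrite /c; field.
  lra.
have pm := pmax _ (mem_set K1).
move/set_mem : pK => /andP[pd pr].
have kqp : k * q p.1 p.2 <= c / 2 by rewrite -kr2 ler_pM2l.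
(* On the inner circle [V] stays below [U 0 0 + c - e * ln d2 + c / 2], hence below its value at
   [(x1, y1)]. *)
have pd' : d2 < q p.1 p.2.
  rewrite lt_neqAle pd andbT; apply/negP => /eqP qE.
  have sd (x y : R) : q x y = d2 -> `|x| < d.
    move=> xy; rewrite -(ltr_pXn2r (n := 2)) ?nnegrE// ?ltW// real_normK ?num_real//.
    by rewrite (le_lt_trans _ d2d)// -xy lerDl sqr_ge0.
  have := dP p.1 p.2 (sd _ _ (esym qE)) (sd _ p.1 _).
  rewrite /q addrC => /(_ (esym qE)); rewrite ltr_norml => /andP[_ H].
  by move: pm kqp V1; rewrite /V -qE; lra.
(* On the outer circle the choice of [T] makes [V] at most [c / 2 - e * ln d2 + U 0 0], again too
   small for a maximum. *)
have pr' : q p.1 p.2 < r2.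
  rewrite lt_neqAle pr andbT; apply/negP => /eqP qE.
  have HT : e * T = `|B| + `|U 0 0| + e * `|ln d2| by rewrite /T mulrC divfK// gt_eqF.
  have HT' : e * T <= e * ln r2 by rewrite ler_pM2l.
  have HB := Ub p.1 p.2.
  have B1 := ler_norm B; have B2 := ler_norm (- U 0 0); rewrite normrN in B2.
  have B3 : e * ln d2 <= e * `|ln d2| by rewrite ler_pM2l// ler_norm.
  by move: pm kqp V1; rewrite /V qE; lra.
have [w /= w0 wP] : exists2 w, 0 < w & forall s t, `|s - p.1| < w -> `|t - p.2| < w ->
    d2 < q s t < r2.
  have : \forall z \near p, d2 < q z.1 z.2 < r2.
    have IE : (fun z : R * R => q z.1 z.2) @^-1` `]d2, r2[ `<=`
        [set z : R * R | d2 < q z.1 z.2 < r2].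
      by move=> z /=; rewrite in_itv.
    apply: (filterS IE).
    apply: (cq p); apply: open_nbhs_nbhs; split; first exact: interval_open.
    by rewrite /= in_itv /= pd' pr'.
  move=> /nbhs_ballP[w /= w0 wP]; exists w => // s t sw tw.
  by apply: (wP (s, t)); split => /=; rewrite /ball /= distrC.
have qpos s t : d2 < q s t < r2 -> 0 < q s t by move=> /andP[/(lt_trans d20)].
have wp1 : `|p.1 - p.1| < w by rewrite subrr normr0.
have wp2 : `|p.2 - p.2| < w by rewrite subrr normr0.
have pmax' s t : `|s - p.1| < w -> `|t - p.2| < w -> V (s, t) <= V p.
  move=> sw tw; apply: pmax; apply: mem_set.
  by rewrite /= !ltW//; case/andP: (wP s t sw tw).
have := @barrier_second_derivative (U ^~ p.2) (Ux ^~ p.2) p.1 (Uxx p.1 p.2)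
  (p.2 ^+ 2) e k w w0 (dUx ^~ p.2) (dUxx p.1 p.2)
  (fun t tw => qpos _ _ (wP t p.2 tw wp2)) (fun t tw => pmax' t p.2 tw wp2).
have := @barrier_second_derivative (U p.1) (Uy p.1) p.2 (Uyy p.1 p.2)
  (p.1 ^+ 2) e k w w0 (dUy p.1) (dUyy p.1 p.2).
have qC t : t ^+ 2 + p.1 ^+ 2 = q p.1 t by rewrite /q addrC.
rewrite !qC => Hy Hx.
have {Hy} : Uyy p.1 p.2 - e * (2 / q p.1 p.2 - 4 * p.2 ^+ 2 / (q p.1 p.2) ^+ 2)
    + 2 * k <= 0.
  by apply: Hy => t tw; rewrite !qC; [exact: qpos (wP _ _ wp1 tw)|exact: (pmax' p.1 t)].
have qn0 : q p.1 p.2 != 0 by rewrite gt_eqF// (lt_trans d20).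
have := harm p.1 p.2; rewrite -/(q p.1 p.2) in Hx *.
(* In the sum of the two tests the logarithm contributes zero, being harmonic, and so does [U]; what
   remains is [4 * k <= 0]. *)
have : 4 * p.1 ^+ 2 / (q p.1 p.2) ^+ 2 + 4 * p.2 ^+ 2 / (q p.1 p.2) ^+ 2
    = 4 / q p.1 p.2.
  have -> : 4 / q p.1 p.2 = 4 * q p.1 p.2 / (q p.1 p.2) ^+ 2 by field.
  by rewrite /q; ring.
move: Hx; set A := 4 * p.1 ^+ 2 / _; set A' := 4 * p.2 ^+ 2 / _.
set q' := q _ _; have -> : 4 / q' = 2 * (2 / q') by rewrite mulrA -natrM.
move: (2 / q') => z Hx AA HU Hy.
have : e * (z - A) + e * (z - A') = 0 by rewrite -mulrDr addrACA -opprD AA; ring.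
lra.
Qed.

End Barrier.

(** * Real directional derivatives of complex-valued functions *)

Section ComplexNumbers.
Variable R : realType.
Local Notation C := (Cplx R).
Implicit Types (a b : C) (t : R).

Lemma CReD a b : complex.Re (a + b) = complex.Re a + complex.Re b.
Proof. by case: a; case: b. Qed.
Lemma CImD a b : complex.Im (a + b) = complex.Im a + complex.Im b.
Proof. by case: a; case: b. Qed.
Lemma CReN a : complex.Re (- a) = - complex.Re a. Proof. by case: a. Qed.
Lemma CImN a : complex.Im (- a) = - complex.Im a. Proof. by case: a. Qed.
Lemma CReM a b : complex.Re (a * b) =
  complex.Re a * complex.Re b - complex.Im a * complex.Im b.
Proof. by case: a; case: b. Qed.
Lemma CImM a b : complex.Im (a * b) =
  complex.Re a * complex.Im b + complex.Im a * complex.Re b.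
Proof. by case: a; case: b. Qed.
Lemma CReJ a : complex.Re (a^*) = complex.Re a. Proof. by case: a. Qed.
Lemma CImJ a : complex.Im (a^*) = - complex.Im a. Proof. by case: a. Qed.
Lemma CReV a : complex.Re (a^-1) =
  complex.Re a / (complex.Re a ^+ 2 + complex.Im a ^+ 2).
Proof. by case: a. Qed.
Lemma CImV a : complex.Im (a^-1) =
  - (complex.Im a / (complex.Re a ^+ 2 + complex.Im a ^+ 2)).
Proof. by case: a. Qed.
Lemma CRei : complex.Re ('i : C) = 0. Proof. by []. Qed.
Lemma CImi : complex.Im ('i : C) = 1. Proof. by []. Qed.

Lemma Ceq a b : complex.Re a = complex.Re b -> complex.Im a = complex.Im b ->
  a = b.
Proof. by case: a => ? ?; case: b => ? ? /= -> ->. Qed.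

Lemma sqr_Re_Im_neq0 a : a != 0 -> complex.Re a ^+ 2 + complex.Im a ^+ 2 != 0.
Proof.
apply: contra_neq => /eqP; rewrite paddr_eq0 ?sqr_ge0// !sqrf_eq0.
by move=> /andP[/eqP? /eqP?]; apply: Ceq.
Qed.

Lemma ltr_normC_Re a t : `|a| < (t%:C)%C -> `|complex.Re a| < t.
Proof.
move=> at_; rewrite -ltcR; apply: le_lt_trans at_; exact: normc_ge_Re.
Qed.

Lemma ltr_normC_Im a t : `|a| < (t%:C)%C -> `|complex.Im a| < t.
Proof.
move=> at_; have := @ltr_normC_Re (- 'i * a) t.
rewrite normrM normrN normCi mul1r => /(_ at_).
by rewrite CReM CReN CImN CRei CImi oppr0 mul0r mulN1r sub0r opprK.
Qed.

Lemma Re_continuous : continuous (@complex.Re R : C -> R).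
Proof.
move=> a; apply/(@cvgrPdist_lt _ _ _ (nbhs (a : C^o)) (nbhs_filter _)) => e e0.
have e0' : 0 < (e%:C)%C :> C by rewrite ltcR.
apply/nbhs_ballP; exists (e%:C)%C => //= b; rewrite /ball /= => ab.
by rewrite -CReN -CReD; exact: ltr_normC_Re.
Qed.

Lemma Im_continuous : continuous (@complex.Im R : C -> R).
Proof.
move=> a; apply/(@cvgrPdist_lt _ _ _ (nbhs (a : C^o)) (nbhs_filter _)) => e e0.
have e0' : 0 < (e%:C)%C :> C by rewrite ltcR.
apply/nbhs_ballP; exists (e%:C)%C => //= b; rewrite /ball /= => ab.
by rewrite -CImN -CImD; exact: ltr_normC_Im.
Qed.

Lemma real_complex_continuous : continuous (fun t : R => (t%:C)%C : C).
Proof.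
move=> a; apply/cvgrPdist_lt => e e0.
have [e1 eE] : exists e1 : R, e = (e1%:C)%C.
  by exists (complex.Re e); case: e e0 => x y /andP[/eqP /= -> _].
have e10 : 0 < e1 by rewrite -ltcR -eE.
apply/nbhs_ballP; exists e1 => //= b; rewrite /ball /= => ab.
rewrite eE -rmorphB /= (_ : `|_| = (`|a - b|%:C)%C) ?ltcR//.
by rewrite /Num.norm /= expr0n addr0 sqrtr_sqr.
Qed.

Lemma Cplx_continuous (T : topologicalType) (f : T -> C) (x : T) :
  {for x, continuous (fun y => complex.Re (f y))} ->
  {for x, continuous (fun y => complex.Im (f y))} -> {for x, continuous f}.
Proof.
move=> cr ci; rewrite /prop_for.
have -> : f = (fun y => ((complex.Re (f y))%:C)%C + 'i * ((complex.Im (f y))%:C)%C).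
  by apply/funext => y; apply: Ceq;
    rewrite ?CReD ?CImD ?CReM ?CImM CRei CImi /=; ring.
apply: cvgD; first exact: (@continuous_comp _ _ C _ (fun t : R => (t%:C)%C : C)
  x cr (@real_complex_continuous _)).
apply: cvgM; first exact: cvg_cst.
exact: (@continuous_comp _ _ C _ (fun t : R => (t%:C)%C : C)
  x ci (@real_complex_continuous _)).
Qed.

Lemma conjC_continuous : continuous (fun a : C => a^*).
Proof.
move=> a; apply: Cplx_continuous.
  rewrite (_ : (fun b : C => complex.Re b^*) = @complex.Re R).
    exact: Re_continuous.
  by apply/funext => b; rewrite CReJ.
rewrite (_ : (fun b : C => complex.Im b^*) = (fun b => - complex.Im b)).
  exact: (@continuousN _ _ _ (@complex.Im R : C -> R) a (@Im_continuous a)).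
by apply/funext => b; rewrite CImJ.
Qed.

End ComplexNumbers.

Section DirectionalDerivatives.
Variables (R : realType) (V : normedModType (Cplx R)).
Local Notation C := (Cplx R).
Implicit Types (f g : V -> C) (v w x y : V) (c d : C).

(** Existence and value are bundled, so that the rules of calculus apply without separate proofs of
    differentiability. *)
Definition is_rderive f v x d :=
  is_derive (0 : R) 1 (re_line f v x) (complex.Re d) /\
  is_derive (0 : R) 1 (im_line f v x) (complex.Im d).

Lemma rderiveP f v x : rderivable f v x -> is_rderive f v x (rderive f v x).
Proof.
by case=> dr di; split; rewrite /rderive /= derive1E; apply: derivableP.
Qed.

Lemma is_rderiveE f v x d : is_rderive f v x d -> rderive f v x = d.
Proof.
by case=> dr di; apply: Ceq; rewrite /rderive /= derive1E; apply: derive_val.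
Qed.

Lemma is_rderivable f v x d : is_rderive f v x d -> rderivable f v x.
Proof. by case=> dr di; split; apply: ex_derive. Qed.

Definition line v x (t : R) : V := x + ((t%:C)%C : C) *: v.

Lemma line0 v x : line v x 0 = x.
Proof. by rewrite /line (_ : ((0 : R)%:C)%C = 0 :> C)// scale0r addr0. Qed.

Lemma lineD v x s t : line v (line v x s) t = line v x (t + s).
Proof.
rewrite /line -addrA -scalerDl; congr (_ + _ *: _).
by apply: Ceq; rewrite ?CReD ?CImD /= ?addr0// addrC.
Qed.

Lemma re_lineE f v x t : re_line f v x t = complex.Re (f (line v x t)).
Proof. by []. Qed.

Lemma im_lineE f v x t : im_line f v x t = complex.Im (f (line v x t)).
Proof. by []. Qed.

(** A directional derivative sees only the restriction to one real line, so maps carrying lines to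
    lines transport it. *)
Lemma rderive_line_eq f g v w x y :
  (forall t, f (line v x t) = g (line w y t)) -> rderive f v x = rderive g w y.
Proof.
move=> fg; rewrite /rderive.
have -> : re_line f v x = re_line g w y.
  by apply/funext => t; rewrite !re_lineE fg.
by have -> : im_line f v x = im_line g w y by apply/funext => t; rewrite !im_lineE fg.
Qed.

Lemma line_continuous v x : continuous (line v x).
Proof.
move=> t; apply: cvgD; first exact: cvg_cst.
by apply: cvgZl; exact: real_complex_continuous.
Qed.

Lemma plane_continuous v w x :
  continuous (fun p : R * R => line w (line v x p.1) p.2).
Proof.
move=> p; apply: cvgD; last first.
  apply: cvgZl; apply: continuous_comp; last exact: real_complex_continuous.
  exact: cvg_snd.
apply: (@continuous_comp _ _ V fst (line v x) p).
  exact: cvg_fst.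
exact: line_continuous.
Qed.

(** Moves the base point from parameter 0 to parameter [t], as needed to differentiate along a whole
    segment. *)
Lemma is_rderive_line f v x d (t : R) : is_rderive f v (line v x t) d ->
  is_derive t 1 (re_line f v x) (complex.Re d) /\
  is_derive t 1 (im_line f v x) (complex.Im d).
Proof.
move=> [dr di].
have E (h k : R -> R) e : (forall s, h s = k (s - t)) ->
    is_derive (0 : R) 1 k e -> is_derive t 1 h e.
  move=> hk; rewrite -(subrr t) => dk.
  have dt : is_derive t (1 : R) (fun s => s - t) 1.
    by apply: is_derive_eq; rewrite subr0.
  have := @is_derive1_comp _ k (fun s => s - t) t _ _ dk dt.
  rewrite mulr1; have -> : h = k \o (fun s => s - t) by apply/funext.
  by [].
split; [apply: E dr|apply: E di] => s;
  by rewrite ?re_lineE ?im_lineE lineD subrK.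
Qed.

Lemma is_rderive_near f g v x d : (\forall y \near x, f y = g y) ->
  is_rderive f v x d -> is_rderive g v x d.
Proof.
move=> fg [dr di].
have fg0 : \forall t \near (0 : R), f (line v x t) = g (line v x t).
  have := @line_continuous v x 0; rewrite /continuous_at line0 => H.
  exact: H fg.
split.
  apply: near_eq_is_derive dr.
  by near=> t; rewrite !re_lineE; congr complex.Re; near: t.
apply: near_eq_is_derive di.
by near=> t; rewrite !im_lineE; congr complex.Im; near: t.
Unshelve. all: by end_near. Qed.

Lemma is_rderive_cst c v x : is_rderive (fun=> c) v x 0.
Proof. by split; exact: is_derive_cst. Qed.

Lemma is_rderiveD f g v x c d : is_rderive f v x c -> is_rderive g v x d ->
  is_rderive (fun y => f y + g y) v x (c + d).
Proof.
move=> [fr fi] [gr gi]; split.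
  have -> : re_line (fun y => f y + g y) v x = re_line f v x + re_line g v x.
    by apply/funext => t; rewrite !re_lineE ?im_lineE CReD.
  by rewrite CReD; exact: is_deriveD.
have -> : im_line (fun y => f y + g y) v x = im_line f v x + im_line g v x.
  by apply/funext => t; rewrite !im_lineE ?re_lineE CImD.
by rewrite CImD; exact: is_deriveD.
Qed.

Lemma is_rderiveM f g v x c d : is_rderive f v x c -> is_rderive g v x d ->
  is_rderive (fun y => f y * g y) v x (c * g x + f x * d).
Proof.
have E0 h : h (line v x 0) = h x :> C by rewrite line0.
move=> [fr fi] [gr gi]; split.
  have -> : re_line (fun y => f y * g y) v x =
      re_line f v x * re_line g v x - im_line f v x * im_line g v x.
    by apply/funext => t; rewrite !re_lineE ?im_lineE CReM.
  apply: is_derive_eq (is_deriveB (is_deriveM fr gr) (is_deriveM fi gi)) _.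
  by rewrite !(re_lineE, im_lineE) !E0 CReD !CReM /GRing.scale /=; ring.
have -> : im_line (fun y => f y * g y) v x =
    re_line f v x * im_line g v x + im_line f v x * re_line g v x.
  by apply/funext => t; rewrite !im_lineE ?re_lineE CImM.
apply: is_derive_eq (is_deriveD (is_deriveM fr gi) (is_deriveM fi gr)) _.
by rewrite !(re_lineE, im_lineE) !E0 CImD !CImM /GRing.scale /=; ring.
Qed.

Lemma is_rderiveJ f v x c : is_rderive f v x c ->
  is_rderive (fun y => (f y)^*) v x c^*.
Proof.
move=> [fr fi]; split.
  have -> : re_line (fun y => (f y)^*) v x = re_line f v x.
    by apply/funext => t; rewrite !re_lineE ?im_lineE CReJ.
  by rewrite CReJ.
have -> : im_line (fun y => (f y)^*) v x = - im_line f v x.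
  by apply/funext => t; rewrite !im_lineE ?re_lineE CImJ.
by rewrite CImJ; exact: is_deriveN.
Qed.

Lemma is_rderiveV f v x c : f x != 0 -> is_rderive f v x c ->
  is_rderive (fun y => (f y)^-1) v x (- (c * (f x)^-1 * (f x)^-1)).
Proof.
have E0 h : h (line v x 0) = h x :> C by rewrite line0.
move=> fx0 [fr fi].
(* The squared modulus along the line; the components of the inverse are [re / q] and [- im / q]. *)
pose q t := re_line f v x t * re_line f v x t + im_line f v x t * im_line f v x t.
have dq := is_deriveD (is_deriveM fr fr) (is_deriveM fi fi).
have q0 : q 0 != 0.
  by rewrite /q !(re_lineE, im_lineE) !E0 -!expr2; exact: sqr_Re_Im_neq0.
have dqV := @is_deriveV _ q 0 _ _ q0 dq.
have nz := sqr_Re_Im_neq0 fx0.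
split.
  have -> : re_line (fun y => (f y)^-1) v x = re_line f v x * (fun t => (q t)^-1).
    by apply/funext => t; rewrite !re_lineE CReV !expr2.
  apply: is_derive_eq (is_deriveM fr dqV) _.
  rewrite /q !(re_lineE, im_lineE) !E0.
  rewrite !(CReN, CImN, CReM, CImM, CReV, CImV) /GRing.scale /=.
  by field.
have -> : im_line (fun y => (f y)^-1) v x = - (im_line f v x * (fun t => (q t)^-1)).
  by apply/funext => t; rewrite !im_lineE CImV !expr2.
apply: is_derive_eq (is_deriveN (is_deriveM fi dqV)) _.
rewrite /q !(re_lineE, im_lineE) !E0.
rewrite !(CReN, CImN, CReM, CImM, CReV, CImV) /GRing.scale /=.
by field.
Qed.

End DirectionalDerivatives.

(** * Closure properties of smooth functions, and the dependence of derivatives on their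
    directions *)

Section SmoothFunctions.
Variables (R : realType) (V : normedModType (Cplx R)) (A : set V).
Hypothesis oA : open A.
Local Notation C := (Cplx R).
Implicit Types (f g : V -> C) (v w x : V) (c d : C).

Lemma near_open f g x : (forall y, A y -> f y = g y) -> A x ->
  \forall y \near x, f y = g y.
Proof. by move=> fg Ax; apply: filterS fg _; exact: open_nbhs_nbhs. Qed.

(** Since [A] is open, agreement on [A] is agreement near each of its points, which continuity and
    derivatives respect. *)
Lemma class_C_eq k f g : (forall y, A y -> f y = g y) ->
  class_C A k f -> class_C A k g.
Proof.
elim: k f g => [|k IHk] f g fg [cf Df].
all: have cg : {in A, continuous g}.
1,3: move=> x /set_mem Ax; rewrite /continuous_at -(fg x Ax).
1,2: apply: cvg_trans (cf x (mem_set Ax)); apply: near_eq_cvg.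
1,2: exact: near_open.
  by split.
have rg v x : A x -> is_rderive g v x (rderive f v x).
  move=> Ax; apply: (@is_rderive_near _ _ f); first exact: near_open.
  by apply: rderiveP; exact: Df.1.
split; first exact: cg.
split=> [v x /(rg v) /is_rderivable dg|v]; first exact: dg.
apply: IHk (Df.2 v) => y Ay; exact/esym/is_rderiveE/rg.
Qed.

Lemma class_CW k f : class_C A k.+1 f -> class_C A k f.
Proof.
elim: k f => [|k IHk] f [cf [df Df]]; first by split.
split; first exact: cf.
by split; [exact: df|move=> v; exact: IHk (Df v)].
Qed.

Lemma class_C_is_rderive k f v x : class_C A k.+1 f -> A x ->
  is_rderive f v x (rderive f v x).
Proof. by move=> [_ [df _]] Ax; apply: rderiveP; exact: df. Qed.

(** Allows the derivative to be supplied by a formula that is valid on [A] only, as the product and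
    quotient rules do. *)
Lemma class_CS k f (Df : V -> V -> C) : {in A, continuous f} ->
  (forall v x, A x -> is_rderive f v x (Df v x)) ->
  (forall v, class_C A k (Df v)) -> class_C A k.+1 f.
Proof.
move=> cf df CDf; split; first exact: cf.
split=> [v x /(df v) /is_rderivable dfv|v]; first exact: dfv.
by apply: class_C_eq (CDf v) => y Ay; exact/esym/is_rderiveE/df.
Qed.

Lemma class_C_cst k c : class_C A k (fun=> c).
Proof.
have cc c' : {in A, continuous (fun=> c' : C)} by move=> x _; exact: cvg_cst.
elim: k c => [|k IHk] c; first by split.
apply: (class_CS (Df := fun _ _ => 0)) => [|v x _|v]; first exact: cc.
  exact: is_rderive_cst.
exact: IHk.
Qed.

Lemma class_CD k f g : class_C A k f -> class_C A k g ->
  class_C A k (fun x => f x + g x).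
Proof.
elim: k f g => [|k IHk] f g Cf Cg.
all: have cfg : {in A, continuous (fun x => f x + g x)} by
  move=> x Ax; apply: cvgD; [exact: Cf.1|exact: Cg.1].
  by split.
apply: (class_CS (Df := fun v x => rderive f v x + rderive g v x) cfg) => [v x Ax|v].
  by apply: is_rderiveD;
    [exact: class_C_is_rderive Cf Ax|exact: class_C_is_rderive Cg Ax].
by apply: IHk; [exact: Cf.2.2|exact: Cg.2.2].
Qed.

Lemma class_CM k f g : class_C A k f -> class_C A k g ->
  class_C A k (fun x => f x * g x).
Proof.
elim: k f g => [|k IHk] f g Cf Cg.
all: have cfg : {in A, continuous (fun x => f x * g x)} by
  move=> x Ax; apply: cvgM; [exact: Cf.1|exact: Cg.1].
  by split.
apply: (class_CS (Df := fun v x => rderive f v x * g x + f x * rderive g v x) cfg)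
  => [v x Ax|v].
  by apply: is_rderiveM;
    [exact: class_C_is_rderive Cf Ax|exact: class_C_is_rderive Cg Ax].
by apply: class_CD; apply: IHk;
  [exact: Cf.2.2|exact: class_CW Cg|exact: class_CW Cf|exact: Cg.2.2].
Qed.

Lemma class_CJ k f : class_C A k f -> class_C A k (fun x => (f x)^*).
Proof.
elim: k f => [|k IHk] f Cf.
all: have cf : {in A, continuous (fun x => (f x)^*)} by
  move=> x Ax; exact: (@continuous_comp _ _ _ f (fun a : C => a^*) x
    (Cf.1 x Ax) (@conjC_continuous R _)).
  by split.
apply: (class_CS (Df := fun v x => (rderive f v x)^*) cf) => [v x Ax|v].
  by apply: is_rderiveJ; exact: class_C_is_rderive Cf Ax.
by apply: IHk; exact: Cf.2.2.
Qed.

Lemma class_CV k f : (forall x, A x -> f x != 0) -> class_C A k f ->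
  class_C A k (fun x => (f x)^-1).
Proof.
move=> f0; elim: k f f0 => [|k IHk] f f0 Cf.
all: have cf : {in A, continuous (fun x => (f x)^-1)} by
  move=> x Ax; apply: cvgV; [exact/f0/set_mem|exact: Cf.1].
  by split.
apply: (class_CS (Df := fun v x => - 1 * (rderive f v x * (f x)^-1 * (f x)^-1)) cf)
  => [v x Ax|v].
  by rewrite mulN1r; apply: is_rderiveV; [exact: f0|exact: class_C_is_rderive Cf Ax].
have CV : class_C A k (fun x => (f x)^-1) by apply: IHk f0 (class_CW Cf).
apply: class_CM; first exact: class_C_cst.
by apply: (class_CM _ CV); apply: (class_CM _ CV); exact: Cf.2.2.
Qed.

Local Notation smooth := (smooth_on A).

Lemma smooth_eq f g : (forall y, A y -> f y = g y) -> smooth f -> smooth g.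
Proof. by move=> fg sf k; exact: class_C_eq (sf k). Qed.

Lemma smooth_cst c : smooth (fun=> c).
Proof. by move=> k; exact: class_C_cst. Qed.

Lemma smoothD f g : smooth f -> smooth g -> smooth (fun x => f x + g x).
Proof. by move=> sf sg k; exact: class_CD. Qed.

Lemma smoothM f g : smooth f -> smooth g -> smooth (fun x => f x * g x).
Proof. by move=> sf sg k; exact: class_CM. Qed.

Lemma smoothJ f : smooth f -> smooth (fun x => (f x)^*).
Proof. by move=> sf k; exact: class_CJ. Qed.

Lemma smoothV f : (forall x, A x -> f x != 0) -> smooth f ->
  smooth (fun x => (f x)^-1).
Proof. by move=> f0 sf k; exact: class_CV. Qed.

Lemma smooth_sum (I : Type) (r : seq I) (P : pred I) (F : I -> V -> C) :
  (forall i, smooth (F i)) -> smooth (fun x => \sum_(i <- r | P i) F i x).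
Proof.
move=> sF; elim: r => [|i r IHr].
  by apply: smooth_eq (smooth_cst 0) => y _; rewrite big_nil.
apply: (@smooth_eq (fun x => (if P i then F i x else 0) +
    \sum_(j <- r | P j) F j x)) => [y _|].
  by rewrite big_cons; case: ifP; rewrite ?add0r.
apply: smoothD => //; case: (P i) => //; exact: smooth_cst.
Qed.

Lemma smooth_prod (I : Type) (r : seq I) (P : pred I) (F : I -> V -> C) :
  (forall i, smooth (F i)) -> smooth (fun x => \prod_(i <- r | P i) F i x).
Proof.
move=> sF; elim: r => [|i r IHr].
  by apply: smooth_eq (smooth_cst 1) => y _; rewrite big_nil.
apply: (@smooth_eq (fun x => (if P i then F i x else 1) *
    \prod_(j <- r | P j) F j x)) => [y _|].
  by rewrite big_cons; case: ifP; rewrite ?mul1r.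
apply: smoothM => //; case: (P i) => //; exact: smooth_cst.
Qed.

Lemma smooth_det n (F : 'I_n -> 'I_n -> V -> C) : (forall i j, smooth (F i j)) ->
  smooth (fun x => \det (\matrix_(i, j) F i j x)).
Proof.
move=> sF; apply: (@smooth_eq (fun x =>
    \sum_(s : 'S_n) (-1) ^+ s * \prod_i F i (s i) x)) => [y _|].
  by apply: eq_bigr => s _; congr (_ * _); apply: eq_bigr => i _; rewrite mxE.
apply: smooth_sum => s; apply: smoothM; first exact: smooth_cst.
by apply: smooth_prod => i; exact: sF.
Qed.

(** Cramer's rule: an entry of the inverse is a cofactor divided by the determinant, both polynomial
    in the entries. *)
Lemma smooth_invmx n (F : 'I_n -> 'I_n -> V -> C) : (forall i j, smooth (F i j)) ->
  (forall x, A x -> \matrix_(i, j) F i j x \in unitmx) ->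
  forall i j, smooth (fun x => invmx (\matrix_(i, j) F i j x) i j).
Proof.
move=> sF uF i j.
apply: (@smooth_eq (fun x => (\det (\matrix_(i, j) F i j x))^-1 *
    ((-1) ^+ (j + i) * \det (\matrix_(k, l) F (lift j k) (lift i l) x)))).
  move=> y Ay; rewrite /invmx uF// !mxE /cofactor; congr (_ * (_ * \det _)).
  by apply/matrixP => k l; rewrite !mxE.
apply: smoothM.
  apply: smoothV; last exact: smooth_det.
  by move=> x /uF; rewrite unitmxE unitfE.
by apply: smoothM; [exact: smooth_cst|exact: smooth_det].
Qed.

Lemma smooth_rderive f v : smooth f -> smooth (rderive f v).
Proof. by move=> sf k; exact: (sf k.+1).2.2. Qed.

Lemma smooth_is_rderive f v x : smooth f -> A x ->
  is_rderive f v x (rderive f v x).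
Proof. by move=> sf; exact: class_C_is_rderive (sf 1%N). Qed.

Lemma smooth_continuous f x : smooth f -> A x -> {for x, continuous f}.
Proof. by move=> sf Ax; apply: (sf 0%N).1; exact: mem_set. Qed.

Lemma is_rderive_linear f v x : (forall x y, f (x + y) = f x + f y) ->
  (forall (t : R) v, f (((t%:C)%C : C) *: v) = (t%:C)%C * f v) ->
  is_rderive f v x (f v).
Proof.
move=> fD fZ.
have E (p q : R) : is_derive (0 : R) 1 (fun t => p + t * q) q.
  have := is_deriveD (is_derive_cst p (0 : R) 1)
    (is_deriveM (is_derive_id (0 : R) 1) (is_derive_cst q (0 : R) 1)).
  move=> /is_derive_eq; apply; rewrite /cst /GRing.scale /=; ring.
have fl t : f (line v x t) = f x + (t%:C)%C * f v by rewrite fD fZ.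
split.
  rewrite (_ : re_line f v x = fun t => complex.Re (f x) + t * complex.Re (f v)).
    exact: E.
  by apply/funext => t; rewrite re_lineE fl CReD CReM /= mul0r subr0.
rewrite (_ : im_line f v x = fun t => complex.Im (f x) + t * complex.Im (f v)).
  exact: E.
by apply/funext => t; rewrite im_lineE fl CImD CImM /= mul0r addr0.
Qed.

Lemma smooth_linear f : continuous f -> (forall x y, f (x + y) = f x + f y) ->
  (forall (t : R) v, f (((t%:C)%C : C) *: v) = (t%:C)%C * f v) -> smooth f.
Proof.
move=> cf fD fZ [|k]; first by split => // x _; exact: cf.
apply: (@class_CS _ _ (fun v _ => f v)) => [x _|v x _|v]; first exact: cf.
- exact: is_rderive_linear.
- exact: class_C_cst.
Qed.

(* Keeps failing unifications from unfolding derivatives down to limits. *)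
Opaque smooth_on rderive.

Lemma lineC v w x s t : line w (line v x s) t = line v (line w x t) s.
Proof. by rewrite /line addrAC. Qed.

Lemma plane_near v w x : A x -> exists2 d : R, 0 < d &
  forall s t, `|s| < d -> `|t| < d -> A (line w (line v x s) t).
Proof.
move=> Ax.
have Axx : A (line w (line v x 0) 0) by rewrite !line0.
have : nbhs ((0, 0) : R * R) ((fun p : R * R => line w (line v x p.1) p.2) @^-1` A).
  by apply: (@plane_continuous _ _ v w x (0, 0)); exact: open_nbhs_nbhs.
move=> /nbhs_ballP[d /= d0 dP]; exists d => // s t sd td.
by apply: (dP (s, t)); split; rewrite /= /ball /= sub0r normrN.
Qed.

Lemma plane_continuous_Re f v w x : A x -> smooth f ->
  {for (0, 0), continuous (fun p : R * R =>
     complex.Re (f (line w (line v x p.1) p.2)))}.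
Proof.
move=> Ax sf.
apply: (@continuous_comp _ _ _ (fun p : R * R => f (line w (line v x p.1) p.2))
  (@complex.Re R : C -> R)); last exact: Re_continuous.
apply: (@continuous_comp _ _ _ (fun p : R * R => line w (line v x p.1) p.2) f).
  exact: plane_continuous.
by rewrite !line0; exact: smooth_continuous.
Qed.

(** Reduces a complex identity that is stable under constant multiples of the function to its real
    part. *)
Lemma Im_as_Re : exists c, forall d, complex.Re (c * d) = complex.Im d.
Proof.
exists (- 'i) => c.
by rewrite CReM CReN CImN CRei CImi oppr0 mul0r mulN1r sub0r opprK.
Qed.

Lemma smoothZ c f : smooth f -> smooth (fun x => c * f x).
Proof. by apply: smoothM; exact: smooth_cst. Qed.

Lemma rderive_eq f g v x : (forall y, A y -> f y = g y) -> smooth f -> A x ->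
  rderive f v x = rderive g v x.
Proof.
move=> fg sf Ax; apply/esym/is_rderiveE; apply: (is_rderive_near (f := f)).
  exact: near_open.
exact: smooth_is_rderive.
Qed.

Lemma rderiveZ c f v x : smooth f -> A x ->
  rderive (fun x => c * f x) v x = c * rderive f v x.
Proof.
move=> sf Ax; have := is_rderiveM (is_rderive_cst c v x) (smooth_is_rderive v sf Ax).
by move=> /is_rderiveE ->; rewrite mul0r add0r.
Qed.

(** Schwarz's theorem for the real part of the function on the plane through [x] spanned by [v] and
    [w]. *)
Lemma rderive_comm f v w x : smooth f -> A x ->
  rderive (rderive f v) w x = rderive (rderive f w) v x.
Proof.
suff H g : smooth g -> A x ->
    complex.Re (rderive (rderive g v) w x) = complex.Re (rderive (rderive g w) v x).
  move=> sf Ax; apply: Ceq; first exact: H.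
  have [c cE] := Im_as_Re; have sif := smoothZ c sf.
  have E u u' : rderive (rderive (fun y => c * f y) u) u' x =
      c * rderive (rderive f u) u' x.
    rewrite -rderiveZ//; last exact: smooth_rderive.
    apply: rderive_eq => //; last exact: smooth_rderive.
    by move=> y Ay; rewrite rderiveZ.
  apply: etrans (esym (cE _)) _; apply: etrans _ (cE _).
  exact: etrans (congr1 _ (esym (E v w))) (etrans (H _ sif Ax) (congr1 _ (E w v))).
move=> sg Ax; have [d d0 dA] := plane_near v w Ax.
have dl h u y t : smooth h -> A (line u y t) ->
    is_derive t (1 : R) (fun t => complex.Re (h (line u y t)))
      (complex.Re (rderive h u (line u y t))).
  move=> sh Ayt.
  by have [] := is_rderive_line (smooth_is_rderive u sh Ayt).
have sv := smooth_rderive v sg; have sw := smooth_rderive w sg.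
have := @mixed_derivatives_eq R
  (fun s t => complex.Re (g (line w (line v x s) t)))
  (fun s t => complex.Re (rderive g v (line w (line v x s) t)))
  (fun s t => complex.Re (rderive g w (line w (line v x s) t)))
  (fun s t => complex.Re (rderive (rderive g v) w (line w (line v x s) t)))
  (fun s t => complex.Re (rderive (rderive g w) v (line w (line v x s) t))) d d0.
rewrite !line0; apply=> [s t sd td|s t sd td|s t sd td|s t sd td||].
- have := dA s t sd td; rewrite lineC => Ast; have := dl _ _ _ _ sg Ast.
  by under eq_fun do rewrite lineC.
- exact: dl (dA s t sd td).
- exact: dl (dA s t sd td).
- have := dA s t sd td; rewrite lineC => Ast; have := dl _ _ _ _ sw Ast.
  by under eq_fun do rewrite lineC.
- by apply: plane_continuous_Re => //; exact: smooth_rderive.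
- by apply: plane_continuous_Re => //; exact: smooth_rderive.
Qed.

Lemma lineDdir v w x t : line (v + w) x t = line w (line v x t) t.
Proof. by rewrite /line scalerDr addrA. Qed.

(** The line in direction [v + w] is the diagonal of the plane spanned by [v] and [w], so
    [derivative_diagonal] applies. *)
Lemma rderive_dirD f v w x : smooth f -> A x ->
  rderive f (v + w) x = rderive f v x + rderive f w x.
Proof.
suff H g : smooth g -> A x -> complex.Re (rderive g (v + w) x) =
    complex.Re (rderive g v x + rderive g w x).
  move=> sf Ax; apply: Ceq; first exact: H.
  have [c cE] := Im_as_Re; have := H _ (smoothZ c sf) Ax; rewrite !rderiveZ//.
  by rewrite -mulrDr !cE.
move=> sg Ax; have [d d0 dA] := plane_near v w Ax.
have dl h u y t : smooth h -> A (line u y t) ->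
    is_derive t (1 : R) (fun t => complex.Re (h (line u y t)))
      (complex.Re (rderive h u (line u y t))).
  move=> sh Ayt.
  by have [] := is_rderive_line (smooth_is_rderive u sh Ayt).
have sv := smooth_rderive v sg; have sw := smooth_rderive w sg.
have := @derivative_diagonal R
  (fun s t => complex.Re (g (line w (line v x s) t)))
  (fun s t => complex.Re (rderive g v (line w (line v x s) t)))
  (fun s t => complex.Re (rderive g w (line w (line v x s) t)))
  (fun t => complex.Re (rderive g (v + w) (line (v + w) x t))) d d0.
rewrite !line0 CReD; apply=> [s t sd td|s t sd td|t td|||].
- have := dA s t sd td; rewrite lineC => Ast; have := dl _ _ _ _ sg Ast.
  by under eq_fun do rewrite lineC.
- exact: dl (dA s t sd td).
- have := dA t t td td; rewrite -lineDdir => Ast; have := dl _ _ _ _ sg Ast.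
  by under eq_fun do rewrite lineDdir.
- exact: plane_continuous_Re.
- exact: plane_continuous_Re.
- have := @plane_continuous_Re _ (v + w) 0 x Ax (smooth_rderive (v + w) sg).
  rewrite (_ : (fun p : R * R => complex.Re (rderive g (v + w)
    (line 0 (line (v + w) x p.1) p.2))) = (fun p : R * R => complex.Re
    (rderive g (v + w) (line (v + w) x p.1)))) //.
  by apply/funext => p; rewrite [line 0 _ _]/line scaler0 addr0.
Qed.

Lemma rderive_dirZ f v x (a : R) : smooth f -> A x ->
  rderive f (((a%:C)%C : C) *: v) x = (a%:C)%C * rderive f v x.
Proof.
move=> sf Ax; have [dr di] := smooth_is_rderive v sf Ax.
have lE t : line (((a%:C)%C : C) *: v) x t = line v x (a * t).
  rewrite /line scalerA; congr (_ + _ *: _).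
  by apply: Ceq; rewrite ?CReM ?CImM /=; ring.
have da : is_derive (0 : R) 1 (fun t => a * t) a.
  by have := is_deriveZ a (is_derive_id (0 : R) 1) => /is_derive_eq; apply;
     rewrite /GRing.scale /= mulr1.
have E (h : R -> R) e : is_derive (0 : R) 1 h e ->
    is_derive (0 : R) 1 (fun t => h (a * t)) (a * e).
  move=> dh; rewrite mulrC; apply: (@is_derive1_comp _ h (fun t => a * t)) da.
  by rewrite mulr0.
apply: is_rderiveE; split.
  rewrite CReM /= mul0r subr0.
  rewrite (_ : re_line _ _ _ = fun t => re_line f v x (a * t)); first exact: E.
  by apply/funext => t; rewrite !re_lineE lE.
rewrite CImM /= mul0r addr0.
rewrite (_ : im_line _ _ _ = fun t => im_line f v x (a * t)); first exact: E.
by apply/funext => t; rewrite !im_lineE lE.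
Qed.

End SmoothFunctions.

(** * Wirtinger derivatives as commuting derivations *)

Record derivation (K : comNzRingType) (T : Type) (A : set T)
    (S : (T -> K) -> Prop) (D : (T -> K) -> T -> K) : Prop := Derivation {
  der_smooth : forall f, S f -> S (D f) ;
  der_eq : forall f g x, (forall y, A y -> f y = g y) -> S f -> A x ->
    D f x = D g x ;
  der_cst : forall c x, A x -> D (fun=> c) x = 0 ;
  derD : forall f g x, S f -> S g -> A x ->
    D (fun y => f y + g y) x = D f x + D g x ;
  derM : forall f g x, S f -> S g -> A x ->
    D (fun y => f y * g y) x = D f x * g x + f x * D g x
}.

(** The algebra behind complex linearity of [wirtinger] in its direction: [j] is the imaginary unit,
    [h] one half, [s + j * t] the scalar, [p] and [q] the derivatives along [v] and ['i *: v], and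
    [- p] the one along ['i *: ('i *: v)]. *)
Lemma imaginary_scale (K : comNzRingType) (s t j h p q : K) : j * j = -1 ->
  h * (s * p + t * q - j * (s * q + t * - p)) = (s + j * t) * (h * (p - j * q)).
Proof.
move=> jj; have -> : (s + j * t) * (h * (p - j * q)) =
  h * (s * p + t * q - j * (s * q + t * - p)) - (j * j + 1) * (h * t * q) by ring.
by rewrite jj addNr mul0r subr0.
Qed.

Lemma imaginary_scale_bar (K : comNzRingType) (s t j h p q : K) : j * j = -1 ->
  h * (s * p + t * q + j * (s * q + t * - p)) = (s - j * t) * (h * (p + j * q)).
Proof.
move=> jj; have jj' : - j * - j = -1 by rewrite mulrNN.
have := imaginary_scale s t h p q jj'; rewrite !mulNr opprK => ->.
by rewrite opprK.
Qed.

Section WirtingerDerivations.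
Variables (R : realType) (V : normedModType (Cplx R)) (A : set V).
Hypothesis oA : open A.
Local Notation C := (Cplx R).
Implicit Types (f g : V -> C) (v w x : V) (a b c d : C).
Local Notation smooth := (smooth_on A).

(** A common form of [wirtinger] and [wirtinger_bar], so that the Leibniz rule and all cases of
    commutation are proved once. *)
Definition rcomb a v b w f x : C := a * rderive f v x + b * rderive f w x.

Lemma rcomb_derivation a v b w : derivation A smooth (rcomb a v b w).
Proof.
split.
- move=> f sf.
  exact: (smoothD oA (smoothZ oA _ (smooth_rderive v sf))
    (smoothZ oA _ (smooth_rderive w sf))).
- move=> f g x fg sf Ax; rewrite /rcomb.
  by rewrite !(rderive_eq oA _ fg sf Ax).
- move=> c x Ax; rewrite /rcomb !(is_rderiveE (is_rderive_cst c _ x)).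
  by rewrite !mulr0 addr0.
- move=> f g x sf sg Ax; rewrite /rcomb.
  have E u := is_rderiveE (is_rderiveD (smooth_is_rderive u sf Ax)
    (smooth_is_rderive u sg Ax)).
  by rewrite !E !mulrDr addrACA.
- move=> f g x sf sg Ax; rewrite /rcomb.
  have E u := is_rderiveE (is_rderiveM (smooth_is_rderive u sf Ax)
    (smooth_is_rderive u sg Ax)).
  rewrite !E; move: (rderive _ _ _) (rderive _ _ _) (rderive _ _ _) (rderive _ _ _)
    (f x) (g x) => p q r s m t; ring.
Qed.

Lemma rcomb_comm a v b w a' v' b' w' f x : smooth f -> A x ->
  rcomb a v b w (rcomb a' v' b' w' f) x = rcomb a' v' b' w' (rcomb a v b w f) x.
Proof.
move=> sf Ax; rewrite {1 3}/rcomb.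
have E u c d y z : rderive (rcomb c y d z f) u x =
    c * rderive (rderive f y) u x + d * rderive (rderive f z) u x.
  rewrite -(rderiveZ c u (smooth_rderive y sf) Ax).
  rewrite -(rderiveZ d u (smooth_rderive z sf) Ax).
  exact: (is_rderiveE (is_rderiveD
    (smooth_is_rderive u (smoothZ oA c (smooth_rderive y sf)) Ax)
    (smooth_is_rderive u (smoothZ oA d (smooth_rderive z sf)) Ax))).
rewrite !E.
rewrite (rderive_comm oA v v' sf Ax) (rderive_comm oA v w' sf Ax).
rewrite (rderive_comm oA w v' sf Ax) (rderive_comm oA w w' sf Ax).
move: (rderive (rderive f v') v x) (rderive (rderive f w') v x)
  (rderive (rderive f v') w x) (rderive (rderive f w') w x) => p q r s; ring.
Qed.

Lemma wirtinger_rcomb v : wirtinger v = rcomb (2^-1) v (- (2^-1 * 'i)) ('i *: v).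
Proof.
by apply/funext => f; apply/funext => x; rewrite /wirtinger /rcomb mulrBr mulrA mulNr.
Qed.

Lemma wirtinger_bar_rcomb v : wirtinger_bar v = rcomb (2^-1) v (2^-1 * 'i) ('i *: v).
Proof.
by apply/funext => f; apply/funext => x; rewrite /wirtinger_bar /rcomb mulrDr mulrA.
Qed.

Lemma wirtinger_derivation v : derivation A smooth (wirtinger v).
Proof. by rewrite wirtinger_rcomb; exact: rcomb_derivation. Qed.

Lemma wirtinger_bar_derivation v : derivation A smooth (wirtinger_bar v).
Proof. by rewrite wirtinger_bar_rcomb; exact: rcomb_derivation. Qed.

Lemma wirtinger_comm v w f x : smooth f -> A x ->
  wirtinger v (wirtinger w f) x = wirtinger w (wirtinger v f) x.
Proof. by rewrite !wirtinger_rcomb; exact: rcomb_comm. Qed.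

Lemma wirtinger_bar_comm v w f x : smooth f -> A x ->
  wirtinger_bar v (wirtinger_bar w f) x = wirtinger_bar w (wirtinger_bar v f) x.
Proof. by rewrite !wirtinger_bar_rcomb; exact: rcomb_comm. Qed.

Lemma wirtinger_wirtinger_bar_comm v w f x : smooth f -> A x ->
  wirtinger v (wirtinger_bar w f) x = wirtinger_bar w (wirtinger v f) x.
Proof. by rewrite wirtinger_rcomb wirtinger_bar_rcomb; exact: rcomb_comm. Qed.

Lemma rderiveJ f v x : smooth f -> A x ->
  rderive (fun y => (f y)^*) v x = (rderive f v x)^*.
Proof. by move=> sf Ax; exact: is_rderiveE (is_rderiveJ (smooth_is_rderive v sf Ax)). Qed.

Lemma conj_wirtinger f v x : smooth f -> A x ->
  (wirtinger v f x)^* = wirtinger_bar v (fun y => (f y)^*) x.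
Proof.
move=> sf Ax; rewrite /wirtinger /wirtinger_bar !rderiveJ// !(rmorphM, rmorphB).
by rewrite /= conjCi mulNr opprK fmorphV rmorph_nat.
Qed.

Lemma conj_wirtinger_bar f v x : smooth f -> A x ->
  (wirtinger_bar v f x)^* = wirtinger v (fun y => (f y)^*) x.
Proof.
move=> sf Ax; rewrite /wirtinger /wirtinger_bar !rderiveJ// !(rmorphM, rmorphD).
by rewrite /= conjCi mulNr fmorphV rmorph_nat.
Qed.

Lemma rderive_dir_complex f v x c : smooth f -> A x ->
  rderive f (c *: v) x =
  ((complex.Re c)%:C)%C * rderive f v x + ((complex.Im c)%:C)%C * rderive f ('i *: v) x.
Proof.
move=> sf Ax; rewrite -!(rderive_dirZ _ _ sf Ax) -(rderive_dirD oA)//.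
congr (rderive f _ x).
rewrite scalerA -scalerDl; congr (_ *: _).
by apply: Ceq; rewrite ?CReD ?CImD ?CReM ?CImM CRei CImi /=; ring.
Qed.

Lemma wirtinger_dirD f v w x : smooth f -> A x ->
  wirtinger (v + w) f x = wirtinger v f x + wirtinger w f x.
Proof.
move=> sf Ax; rewrite /wirtinger scalerDr !(rderive_dirD oA)//.
move: (rderive _ _ _) (rderive _ _ _) (rderive _ _ _) (rderive _ _ _) => *; ring.
Qed.

Lemma wirtinger_bar_dirD f v w x : smooth f -> A x ->
  wirtinger_bar (v + w) f x = wirtinger_bar v f x + wirtinger_bar w f x.
Proof.
move=> sf Ax; rewrite /wirtinger_bar scalerDr !(rderive_dirD oA)//.
move: (rderive _ _ _) (rderive _ _ _) (rderive _ _ _) (rderive _ _ _) => *; ring.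
Qed.

Lemma CReIm c : c = ((complex.Re c)%:C)%C + 'i * ((complex.Im c)%:C)%C.
Proof. by apply: Ceq; rewrite ?CReD ?CImD ?CReM ?CImM CRei CImi /=; ring. Qed.

Lemma CJReIm c : c^* = ((complex.Re c)%:C)%C - 'i * ((complex.Im c)%:C)%C.
Proof.
by apply: Ceq; rewrite ?CReD ?CImD ?CReN ?CImN ?CReM ?CImM ?CReJ ?CImJ CRei CImi /=;
  ring.
Qed.

Lemma rderive_dir_ii f v x : smooth f -> A x ->
  rderive f ('i *: ('i *: v)) x = - rderive f v x.
Proof.
move=> sf Ax; rewrite scalerA -expr2 sqrCi.
have := rderive_dirZ v (-1) sf Ax.
rewrite (_ : ((-1 : R)%:C)%C = -1 :> C); last by apply: Ceq; rewrite /= ?oppr0.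
by rewrite mulN1r.
Qed.

Lemma wirtinger_dirZ f v x c : smooth f -> A x ->
  wirtinger (c *: v) f x = c * wirtinger v f x.
Proof.
move=> sf Ax; rewrite /wirtinger.
have -> : 'i *: (c *: v) = c *: ('i *: v) by rewrite !scalerA mulrC.
rewrite (rderive_dir_complex v c sf Ax) (rderive_dir_complex ('i *: v) c sf Ax).
rewrite rderive_dir_ii// [in RHS](CReIm c).
have := sqrCi C; rewrite expr2.
exact: imaginary_scale.
Qed.

Lemma wirtinger_bar_dirZ f v x c : smooth f -> A x ->
  wirtinger_bar (c *: v) f x = c^* * wirtinger_bar v f x.
Proof.
move=> sf Ax; rewrite /wirtinger_bar.
have -> : 'i *: (c *: v) = c *: ('i *: v) by rewrite !scalerA mulrC.
rewrite (rderive_dir_complex v c sf Ax) (rderive_dir_complex ('i *: v) c sf Ax).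
rewrite rderive_dir_ii// [in RHS](CJReIm c).
have := sqrCi C; rewrite expr2.
exact: imaginary_scale_bar.
Qed.

Lemma wirtinger_dir_sum (I : Type) (r : seq I) (F : I -> V) f x :
  smooth f -> A x ->
  wirtinger (\sum_(i <- r) F i) f x = \sum_(i <- r) wirtinger (F i) f x.
Proof.
move=> sf Ax; elim: r => [|i r IHr].
  by rewrite !big_nil -(scale0r (0 : V)) wirtinger_dirZ// mul0r.
by rewrite !big_cons wirtinger_dirD// IHr.
Qed.

Lemma wirtinger_bar_dir_sum (I : Type) (r : seq I) (F : I -> V) f x :
  smooth f -> A x ->
  wirtinger_bar (\sum_(i <- r) F i) f x = \sum_(i <- r) wirtinger_bar (F i) f x.
Proof.
move=> sf Ax; elim: r => [|i r IHr].
  by rewrite !big_nil -(scale0r (0 : V)) wirtinger_bar_dirZ// conjC0 mul0r.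
by rewrite !big_cons wirtinger_bar_dirD// IHr.
Qed.

Lemma rderive_linear f v x : (forall x y, f (x + y) = f x + f y) ->
  (forall c v, f (c *: v) = c * f v) -> rderive f v x = f v.
Proof.
by move=> fD fZ; apply/is_rderiveE/is_rderive_linear => // t w; exact: fZ.
Qed.

Lemma wirtinger_linear f v x : (forall x y, f (x + y) = f x + f y) ->
  (forall c v, f (c *: v) = c * f v) -> wirtinger v f x = f v.
Proof.
move=> fD fZ; rewrite /wirtinger !rderive_linear// fZ mulrA -expr2 sqrCi.
by rewrite mulN1r opprK -mulr2n mulrnAr -mulrnAl -mulr_natr mulVf ?mul1r// pnatr_eq0.
Qed.

Lemma wirtinger_bar_linear f v x : (forall x y, f (x + y) = f x + f y) ->
  (forall c v, f (c *: v) = c * f v) -> wirtinger_bar v f x = 0.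
Proof.
move=> fD fZ; rewrite /wirtinger_bar !rderive_linear// fZ mulrA -expr2 sqrCi.
by rewrite mulN1r subrr mulr0.
Qed.

End WirtingerDerivations.

(** * Tensor calculus of the complex spray *)

Section DerivationSums.
Variables (K : comNzRingType) (T : Type) (A : set T) (S : (T -> K) -> Prop).
Hypothesis S_cst : forall c, S (fun=> c).
Hypothesis SD : forall f g, S f -> S g -> S (fun x => f x + g x).
Hypothesis SM : forall f g, S f -> S g -> S (fun x => f x * g x).
Hypothesis S_eq : forall f g, (forall y, A y -> f y = g y) -> S f -> S g.
Variable D : (T -> K) -> T -> K.
Hypothesis derD_ : derivation A S D.

Lemma S_sum (I : Type) (r : seq I) (F : I -> T -> K) :
  (forall i, S (F i)) -> S (fun x => \sum_(i <- r) F i x).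
Proof.
move=> sF; elim: r => [|i r IHr].
  by apply: S_eq (S_cst 0) => y _; rewrite big_nil.
by apply: S_eq (SD (sF i) IHr) => y _; rewrite big_cons.
Qed.

Lemma der_sum (I : Type) (r : seq I) (F : I -> T -> K) x :
  (forall i, S (F i)) -> A x ->
  D (fun x => \sum_(i <- r) F i x) x = \sum_(i <- r) D (F i) x.
Proof.
move=> sF Ax; elim: r => [|i r IHr].
  rewrite big_nil; apply: etrans (der_cst derD_ 0 Ax).
  by apply: (der_eq derD_ _ _ Ax) => [y _|]; [rewrite big_nil|exact: S_sum].
rewrite big_cons -IHr -(derD derD_)//; last exact: S_sum.
by apply: (der_eq derD_ _ _ Ax) => [y _|]; [rewrite big_cons|exact: S_sum].
Qed.

Lemma der_sumM (I : Type) (r : seq I) (F H : I -> T -> K) x :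
  (forall i, S (F i)) -> (forall i, S (H i)) -> A x ->
  D (fun x => \sum_(i <- r) F i x * H i x) x =
  \sum_(i <- r) D (F i) x * H i x + \sum_(i <- r) F i x * D (H i) x.
Proof.
move=> sF sH Ax; rewrite der_sum//; last by move=> i; exact: SM.
by rewrite -big_split; apply: eq_bigr => i _; exact: (derM derD_).
Qed.

Lemma derZ c f x : S f -> A x -> D (fun x => c * f x) x = c * D f x.
Proof. by move=> sf Ax; rewrite (derM derD_)// (der_cst derD_)// mul0r add0r. Qed.

Lemma S_opp f : S f -> S (fun x => - f x).
Proof. by move=> sf; apply: S_eq (SM (S_cst (-1)) sf) => y _; rewrite mulN1r. Qed.

Lemma derB f g x : S f -> S g -> A x -> D (fun x => f x - g x) x = D f x - D g x.
Proof.
move=> sf sg Ax; rewrite (derD derD_)//; last exact: S_opp.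
congr (_ + _); rewrite -mulN1r -derZ//.
by apply: (der_eq derD_ _ _ Ax) => [y _|]; [rewrite mulN1r|exact: S_opp].
Qed.

End DerivationSums.

Section SprayCalculus.
Variables (K : numClosedFieldType) (n : nat) (T : Type) (A : set T).
Variables (S : (T -> K) -> Prop) (isD : ((T -> K) -> T -> K) -> Prop).
Variables (eta : 'I_n -> T -> K) (dz dzb de deb : 'I_n -> (T -> K) -> T -> K).
Variable L : T -> K.

(* [tg], [tC], [tN], [tG], [tcN], [tB], [tBb] abstract [metric], [cartan],
   [cfN], [spray], [cN], [berwald], [berwald_bar]: the derivations are variables
   here, so that unification cannot unfold them into real derivatives.  [S] is
   the class of smooth functions on [A]. *)
Definition tg i j : T -> K := de i (deb j L).
Definition tgmx x : 'M[K]_n := \matrix_(i, j) tg i j x.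
Definition tginv j i x : K := invmx (tgmx x) j i.
Definition tC i j k : T -> K := de k (tg i j).
Definition tN i j x : K :=
  \sum_m \sum_l tginv m i x * dz j (tg l m) x * eta l x.
Definition tG i x : K := 2^-1 * \sum_j tN i j x * eta j x.
Definition tcN i j : T -> K := de j (tG i).
Definition tdelta k (f : T -> K) x : K := dz k f x - \sum_j tcN j k x * de j f x.
Definition tdeltab k (f : T -> K) x : K :=
  dzb k f x - \sum_j (tcN j k x)^* * deb j f x.
Definition tB i j k : T -> K := de k (tcN i j).
Definition tBb i j k : T -> K := deb k (tcN i j).
Definition trund i j k x : K :=
  2^-1 * \sum_l tginv l i x * (tdelta k (tg j l) x + tdelta j (tg k l) x).
Definition trundb i j k x : K :=
  2^-1 * \sum_l tginv l i x * (tdeltab k (tg j l) x - tdeltab l (tg j k) x).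
Definition thcov2 (F : 'I_n -> 'I_n -> T -> K) i j k x : K :=
  tdelta k (F i j) x
  - \sum_l tB l i k x * F l j x
  - \sum_m (tBb m j k x)^* * F i m x.
Definition thcov3 (F : 'I_n -> 'I_n -> 'I_n -> T -> K) i j h k x : K :=
  tdelta k (F i j h) x
  - \sum_l tB l i k x * F l j h x
  - \sum_m (tBb m j k x)^* * F i m h x
  - \sum_l tB l h k x * F i j l x.
Definition thbarcov3 (F : 'I_n -> 'I_n -> 'I_n -> T -> K) i j h k x : K :=
  tdeltab k (F i j h) x
  - \sum_l tBb l i k x * F l j h x
  - \sum_m (tB m j k x)^* * F i m h x
  - \sum_l tBb l h k x * F i j l x.

(** [isD] singles out a class of pairwise commuting derivations. The last five fields are the Euler
    relations: in [eta], the function [deb j L] has degree 1, the metric degree 0 and the spray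
    degree 2, and the conjugate of [eta] contributes no degree. *)
Record spray_setting : Prop := SpraySetting {
  ss_S_cst : forall c, S (fun=> c) ;
  ss_SD : forall f g, S f -> S g -> S (fun x => f x + g x) ;
  ss_SM : forall f g, S f -> S g -> S (fun x => f x * g x) ;
  ss_SJ : forall f, S f -> S (fun x => (f x)^*) ;
  ss_S_eq : forall f g, (forall y, A y -> f y = g y) -> S f -> S g ;
  ss_isD_der : forall D, isD D -> derivation A S D ;
  ss_isD_comm : forall D E f x, isD D -> isD E -> S f -> A x ->
    D (E f) x = E (D f) x ;
  ss_isD_dz : forall k, isD (dz k) ;
  ss_isD_dzb : forall k, isD (dzb k) ;
  ss_isD_de : forall k, isD (de k) ;
  ss_isD_deb : forall k, isD (deb k) ;
  ss_S_eta : forall i, S (eta i) ;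
  ss_dz_eta : forall k l x, A x -> dz k (eta l) x = 0 ;
  ss_de_eta : forall k l x, A x -> de k (eta l) x = (k == l)%:R ;
  ss_deb_eta : forall k l x, A x -> deb k (eta l) x = 0 ;
  ss_conj_dz : forall k f x, S f -> A x -> (dz k f x)^* = dzb k (fun y => (f y)^*) x ;
  ss_conj_de : forall k f x, S f -> A x -> (de k f x)^* = deb k (fun y => (f y)^*) x ;
  ss_conj_deb : forall k f x, S f -> A x -> (deb k f x)^* = de k (fun y => (f y)^*) x ;
  ss_S_L : S L ;
  ss_L_real : forall x, A x -> (L x)^* = L x ;
  ss_tg_unit : forall x, A x -> tgmx x \in unitmx ;
  ss_S_tginv : forall i j, S (tginv i j) ;
  ss_euler_L : forall j x, A x -> \sum_k eta k x * tg k j x = deb j L x ;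
  ss_euler_tg : forall i j x, A x -> \sum_k eta k x * tC i j k x = 0 ;
  ss_euler_tg_bar : forall i j x, A x -> \sum_k (eta k x)^* * deb k (tg i j) x = 0 ;
  ss_euler_tG : forall i x, A x -> \sum_k eta k x * tcN i k x = 2 * tG i x ;
  ss_euler_tG_bar : forall i x, A x -> \sum_k (eta k x)^* * deb k (tG i) x = 0
}.

Hypothesis setting : spray_setting.
Let S_cst := ss_S_cst setting.
Let SD := ss_SD setting.
Let SM := ss_SM setting.
Let SJ := ss_SJ setting.
Let S_eq := ss_S_eq setting.
Let isD_der := ss_isD_der setting.
Let isD_comm := ss_isD_comm setting.
Let isD_dz := ss_isD_dz setting.
Let isD_dzb := ss_isD_dzb setting.
Let isD_de := ss_isD_de setting.
Let isD_deb := ss_isD_deb setting.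
Let S_eta := ss_S_eta setting.
Let dz_eta := ss_dz_eta setting.
Let de_eta := ss_de_eta setting.
Let deb_eta := ss_deb_eta setting.
Let conj_dz := ss_conj_dz setting.
Let conj_de := ss_conj_de setting.
Let conj_deb := ss_conj_deb setting.
Let S_L := ss_S_L setting.
Let L_real := ss_L_real setting.
Let tg_unit := ss_tg_unit setting.
Let S_tginv := ss_S_tginv setting.
Let euler_L := ss_euler_L setting.
Let euler_tg := ss_euler_tg setting.
Let euler_tg_bar := ss_euler_tg_bar setting.
Let euler_tG := ss_euler_tG setting.
Let euler_tG_bar := ss_euler_tG_bar setting.

Implicit Types (i j k l m h p r : 'I_n) (x : T) (f : T -> K).

Let S_sum' I (r : seq I) F := @S_sum _ _ _ _ S_cst SD S_eq I r F.
Let d_sumM D (HD : isD D) I (s : seq I) F H x :=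
  @der_sumM _ _ _ _ S_cst SD SM S_eq D (isD_der HD) I s F H x.
Let d_Z D (HD : isD D) c f x :=
  @derZ _ _ _ _ S_cst D (isD_der HD) c f x.
Let d_B D (HD : isD D) f g x :=
  @derB _ _ _ _ S_cst SM S_eq D (isD_der HD) f g x.

Lemma S_der D f : isD D -> S f -> S (D f).
Proof. by move=> /isD_der /der_smooth; apply. Qed.

Lemma der_ext D f g x : isD D -> (forall y, A y -> f y = g y) -> S f -> A x ->
  D f x = D g x.
Proof. by move=> /isD_der /der_eq; apply. Qed.

Lemma S_debL j : S (deb j L).
Proof. exact: S_der. Qed.

Lemma S_tg i j : S (tg i j).
Proof. by do 2!apply: S_der => //. Qed.

Lemma S_tC i j k : S (tC i j k).
Proof. by apply: S_der => //; exact: S_tg. Qed.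

Lemma S_tN i j : S (tN i j).
Proof.
apply: S_sum' => m; apply: S_sum' => l; apply: SM (S_eta _); apply: SM => //.
by apply: S_der => //; exact: S_tg.
Qed.

Lemma S_tG i : S (tG i).
Proof.
apply: SM => //; apply: S_sum' => j; apply: SM => //; exact: S_tN.
Qed.

Lemma S_tcN i j : S (tcN i j).
Proof. by apply: S_der => //; exact: S_tG. Qed.

Lemma S_tB i j k : S (tB i j k).
Proof. by apply: S_der => //; exact: S_tcN. Qed.

Lemma S_tdelta k f : S f -> S (tdelta k f).
Proof.
move=> sf; apply: SD; first exact: S_der.
apply: (S_opp S_cst SM S_eq); apply: S_sum' => j.
by apply: SM; [exact: S_tcN|exact: S_der].
Qed.

(** [L] is real, conjugation exchanges [de] and [deb], and these commute. *)
Lemma tg_conj i j x : A x -> (tg i j x)^* = tg j i x.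
Proof.
move=> Ax; rewrite /tg conj_de//; last exact: S_der.
rewrite (isD_comm (isD_de j) (isD_deb i) S_L Ax).
apply: der_ext => //; last by apply: SJ; exact: S_der.
by move=> y Ay; rewrite conj_deb//; apply: der_ext => //; exact: SJ.
Qed.

Lemma tC_sym i j k x : A x -> tC i j k x = tC k j i x.
Proof.
by move=> Ax; apply: (isD_comm (isD_de k) (isD_de i) _ Ax); exact: S_der.
Qed.

Lemma tC_der_sym i m k h x : A x -> de h (tC i m k) x = de i (tC k m h) x.
Proof.
move=> Ax; apply/esym; apply: etrans (isD_comm (isD_de i) (isD_de h) (S_tg _ _) Ax) _.
by apply: der_ext (S_tC _ _ _) Ax => // y; exact: tC_sym.
Qed.

Lemma tB_sym i j k x : A x -> tB i j k x = tB i k j x.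
Proof. by move=> Ax; exact: (isD_comm (isD_de k) (isD_de j) (S_tG i) Ax). Qed.

Lemma tginvR k i x : A x -> \sum_j tg k j x * tginv j i x = (k == i)%:R.
Proof.
move=> Ax; have := congr1 (fun M : 'M[K]_n => M k i) (mulmxV (tg_unit Ax)).
rewrite !mxE => <-.
by apply: eq_bigr => j _; rewrite mxE.
Qed.

Lemma tginvL j k x : A x -> \sum_i tginv j i x * tg i k x = (j == k)%:R.
Proof.
move=> Ax; have := congr1 (fun M : 'M[K]_n => M j k) (mulVmx (tg_unit Ax)).
rewrite !mxE => <-.
by apply: eq_bigr => i _; rewrite mxE.
Qed.

Lemma sum_delta (a : 'I_n -> K) m : \sum_i (i == m)%:R * a i = a m.
Proof.
rewrite (bigD1 m)//= eqxx mul1r big1 ?addr0// => i /negPf im.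
by rewrite im mul0r.
Qed.

Lemma tg_raise (a : 'I_n -> K) m x : A x ->
  \sum_i tg i m x * (\sum_l tginv l i x * a l) = a m.
Proof.
move=> Ax; under eq_bigr do rewrite mulr_sumr.
rewrite exchange_big /= -[RHS]sum_delta; apply: eq_bigr => l _.
by rewrite -(tginvL l m Ax) mulr_suml; apply: eq_bigr => i _; rewrite mulrCA mulrA.
Qed.

(** Since the metric is invertible, identities with an upper index may be tested after lowering
    it. *)
Lemma tg_inj (a b : 'I_n -> K) x : A x ->
  (forall m, \sum_i tg i m x * a i = \sum_i tg i m x * b i) -> forall i, a i = b i.
Proof.
move=> Ax ab; have E (c : 'I_n -> K) i :
    \sum_m tginv m i x * (\sum_k tg k m x * c k) = c i.
  under eq_bigr do rewrite mulr_sumr.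
  rewrite exchange_big /= -[RHS]sum_delta; apply: eq_bigr => k _.
  by rewrite -(tginvR k i Ax) mulr_suml; apply: eq_bigr => m _; rewrite mulrCA mulrA.
by move=> i; rewrite -(E a) -(E b); apply: eq_bigr => m _; rewrite ab.
Qed.

(** The Euler relation of [deb m L], differentiated by [dz j], for which [eta] is constant. *)
Lemma sum_dz_tg j m x : A x -> \sum_l dz j (tg l m) x * eta l x = dz j (deb m L) x.
Proof.
move=> Ax; have E y : A y -> deb m L y = \sum_l eta l y * tg l m y.
  by move=> Ay; rewrite euler_L.
rewrite (der_ext (isD_dz j) E)//; last exact: S_der.
rewrite d_sumM//; last by move=> i; exact: S_tg.
rewrite [X in X + _]big1 ?add0r => [|l _]; last by rewrite dz_eta// mul0r.
by apply: eq_bigr => l _; rewrite mulrC.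
Qed.

(** The Euler relation removes the contraction with [eta l] inside [tN], and lowering the index
    cancels the inverse metric. *)
Lemma spray_lowered m x : A x ->
  \sum_i tg i m x * tG i x = 2^-1 * \sum_j eta j x * dz j (deb m L) x.
Proof.
move=> Ax.
have E i : tG i x = \sum_l tginv l i x * (2^-1 * \sum_j eta j x * dz j (deb l L) x).
  rewrite /tG mulr_sumr; under [RHS]eq_bigr do rewrite !mulr_sumr.
  rewrite exchange_big; apply: eq_bigr => j _.
  rewrite /tN mulr_suml mulr_sumr; apply: eq_bigr => l _.
  rewrite -sum_dz_tg// !mulr_suml !mulr_sumr; apply: eq_bigr => k _.
  by rewrite -!mulrA mulrCA; congr (_ * (_ * _)); rewrite mulrA mulrC.
under eq_bigr do rewrite E.
exact: tg_raise.
Qed.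

Lemma de_sum_eta h (F : 'I_n -> T -> K) x : (forall i, S (F i)) -> A x ->
  de h (fun y => \sum_j eta j y * F j y) x = F h x + \sum_j eta j x * de h (F j) x.
Proof.
move=> sF Ax; rewrite d_sumM//; congr (_ + _).
rewrite -[RHS](sum_delta (fun i => F i x)); apply: eq_bigr => j _.
by rewrite de_eta// eq_sym.
Qed.

Lemma S_dz_debL j m : S (dz j (deb m L)).
Proof. by do 2!apply: S_der => //. Qed.

(** On the right, the first term comes from [de k] acting on the factor [eta j], the sum from its
    action on [dz j (deb m L)]. *)
Lemma spray_lowered_de k m x : A x ->
  \sum_i tC i m k x * tG i x + \sum_i tg i m x * tcN i k x =
  2^-1 * (dz k (deb m L) x + \sum_j eta j x * dz j (tg k m) x).
Proof.
move=> Ax.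
have s0 : S (fun y => \sum_i tg i m y * tG i y).
  by apply: S_sum' => i; apply: SM; [exact: S_tg|exact: S_tG].
have := der_ext (isD_de k) (spray_lowered m) s0 Ax.
rewrite d_sumM//; [|by move=> i; exact: S_tg|exact: S_tG] => ->.
rewrite d_Z//; last by apply: S_sum' => i; apply: SM => //; exact: S_dz_debL.
rewrite de_sum_eta//; last by move=> i; exact: S_dz_debL.
congr (_ * (_ + _)); apply: eq_bigr => j _; congr (_ * _).
exact: (isD_comm (isD_de k) (isD_dz j) (S_debL m) Ax).
Qed.

Lemma spray_lowered_de_de k h m x : A x ->
  \sum_i de h (tC i m k) x * tG i x + \sum_i tC i m k x * tcN i h x +
  (\sum_i tC i m h x * tcN i k x + \sum_i tg i m x * tB i k h x) =
  2^-1 * (dz k (tg h m) x + (dz h (tg k m) x + \sum_j eta j x * dz j (tC k m h) x)).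
Proof.
move=> Ax.
have s1 : S (fun y => \sum_i tC i m k y * tG i y).
  by apply: S_sum' => i; apply: SM; [exact: S_tC|exact: S_tG].
have s2 : S (fun y => \sum_i tg i m y * tcN i k y).
  by apply: S_sum' => i; apply: SM; [exact: S_tg|exact: S_tcN].
have s3 i j l : S (dz i (tg j l)) by apply: S_der => //; exact: S_tg.
have s4 : S (fun y => \sum_j eta j y * dz j (tg k m) y).
  by apply: S_sum' => i; exact: SM.
have := der_ext (isD_de h) (spray_lowered_de k m) (SD s1 s2) Ax.
rewrite (derD (isD_der (isD_de h)))// !d_sumM//;
  [|by move=> i; exact: S_tg|by move=> i; exact: S_tcN
   |by move=> i; exact: S_tC|exact: S_tG] => ->.
rewrite d_Z//; last by apply: SD => //; exact: S_dz_debL.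
rewrite (derD (isD_der (isD_de h)))//; last exact: S_dz_debL.
rewrite de_sum_eta//; congr (_ * (_ + (_ + _))).
  exact: (isD_comm (isD_de h) (isD_dz k) (S_debL m) Ax).
apply: eq_bigr => j _; congr (_ * _).
exact: (isD_comm (isD_de h) (isD_dz j) (S_tg k m) Ax).
Qed.

(** Differentiating the Euler relation of [tG] along [eta j] lowers the degree from 2 to 1. *)
Lemma euler_tB i j x : A x -> \sum_k eta k x * tB i j k x = tcN i j x.
Proof.
move=> Ax.
have s0 : S (fun y => \sum_k eta k y * tcN i k y).
  by apply: S_sum' => k; apply: SM => //; exact: S_tcN.
have := der_ext (isD_de j) (euler_tG i) s0 Ax.
rewrite de_sum_eta//; last by move=> k; exact: S_tcN.
rewrite d_Z//; last exact: S_tG.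
rewrite mulrDl !mul1r => /addrI E; rewrite -[RHS]E.
by apply: eq_bigr => k _; rewrite tB_sym.
Qed.

Lemma euler_tB' i j x : A x -> \sum_k eta k x * tB i k j x = tcN i j x.
Proof. by move=> Ax; rewrite -euler_tB//; apply: eq_bigr => k _; rewrite tB_sym. Qed.

Lemma de_conj_eta k l x : A x -> de k (fun y => (eta l y)^*) x = 0.
Proof. by move=> Ax; rewrite -conj_deb// deb_eta// conjC0. Qed.

Lemma dzb_conj_eta k l x : A x -> dzb k (fun y => (eta l y)^*) x = 0.
Proof. by move=> Ax; rewrite -conj_dz// dz_eta// conjC0. Qed.

Lemma der_sum_conj_eta D (F : 'I_n -> T -> K) x : isD D ->
  (forall l, D (fun y => (eta l y)^*) x = 0) -> (forall i, S (F i)) -> A x ->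
  D (fun y => \sum_l (eta l y)^* * F l y) x = \sum_l (eta l x)^* * D (F l) x.
Proof.
move=> HD D0 sF Ax; rewrite d_sumM//; last by move=> l; exact: SJ.
by rewrite big1 ?add0r// => l _; rewrite D0 mul0r.
Qed.

(** The conjugate of [eta] is constant for [de j], so differentiating the barred Euler relation of
    [tG] only hits [deb k (tG i)]. *)
Lemma euler_tBb i j x : A x -> \sum_k (eta k x)^* * tBb i j k x = 0.
Proof.
move=> Ax.
have sd k : S (deb k (tG i)) by apply: S_der => //; exact: S_tG.
have s0 : S (fun y => \sum_k (eta k y)^* * deb k (tG i) y).
  by apply: S_sum' => k; apply: SM => //; exact: SJ.
have := der_ext (isD_de j) (euler_tG_bar i) s0 Ax.
rewrite der_sum_conj_eta//; last by move=> l; exact: de_conj_eta.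
rewrite (der_cst (isD_der (isD_de j)) _ Ax) => E.
rewrite -[RHS]E; apply: eq_bigr => k _.
by rewrite (isD_comm (isD_de j) (isD_deb k) (S_tG i) Ax).
Qed.

Lemma conj_euler_tBb i j x : A x -> \sum_k eta k x * (tBb i j k x)^* = 0.
Proof.
move=> Ax; rewrite -[RHS]conjC0 -[in RHS](euler_tBb i j Ax) rmorph_sum.
by apply: eq_bigr => k _; rewrite rmorphM /= conjCK.
Qed.

(** The pattern of a contracted connection term: [e] is [eta] or its conjugate, [a] a connection
    coefficient, and [b] its contraction as given by an Euler relation. *)
Lemma contract_sum (e : 'I_n -> K) (a : 'I_n -> 'I_n -> K) (b F : 'I_n -> K) :
  (forall l, \sum_j e j * a l j = b l) ->
  \sum_j (\sum_l a l j * F l) * e j = \sum_l b l * F l.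
Proof.
move=> ab; under eq_bigr do rewrite mulr_suml.
rewrite exchange_big; apply: eq_bigr => l _; rewrite -ab mulr_suml.
by apply: eq_bigr => j _; rewrite mulrAC [RHS]mulrC [e j * _]mulrC mulrC.
Qed.

(** Contracted with [eta], the adapted frame becomes the spray vector field, because [tcN] contracts
    to [2 * tG]. *)
Lemma contract_tdelta f x : A x -> \sum_j tdelta j f x * eta j x =
  \sum_j eta j x * dz j f x - 2 * \sum_p tG p x * de p f x.
Proof.
move=> Ax; under eq_bigr do rewrite mulrBl; rewrite sumrB; congr (_ - _).
  by apply: eq_bigr => j _; rewrite mulrC.
rewrite (contract_sum (b := fun p => 2 * tG p x)) => [|l]; last exact: euler_tG.
by rewrite mulr_sumr; apply: eq_bigr => p _; rewrite mulrA.
Qed.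

Lemma half_eq (a b : K) : a = 2^-1 * b -> 2 * a = b.
Proof. by move=> ->; rewrite mulrA divff ?mul1r// pnatr_eq0. Qed.

Lemma rund_lowered j k m x : A x -> \sum_i tg i m x * trund i j k x =
  2^-1 * (tdelta k (tg j m) x + tdelta j (tg k m) x).
Proof.
move=> Ax; rewrite -(tg_raise (fun m => 2^-1 * (tdelta k (tg j m) x +
  tdelta j (tg k m) x)) m Ax).
apply: eq_bigr => i _; congr (_ * _); rewrite /trund mulr_sumr.
by apply: eq_bigr => l _; rewrite mulrCA.
Qed.

(** Contraction turns the unbarred Berwald terms into terms in [tcN] and kills the barred one. What
    is left is the difference of the twice differentiated spray equation and the lowered Rund
    coefficients. *)
Lemma hcov3_cartan_contracted k m h x : A x ->
  \sum_j thcov3 tC k m h j x * eta j x =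
  2 * \sum_i tg i m x * (tB i k h x - trund i k h x).
Proof.
move=> Ax.
have -> : \sum_j thcov3 tC k m h j x * eta j x =
    \sum_j tdelta j (tC k m h) x * eta j x
    - \sum_j (\sum_l tB l k j x * tC l m h x) * eta j x
    - \sum_j (\sum_r (tBb r m j x)^* * tC k r h x) * eta j x
    - \sum_j (\sum_l tB l h j x * tC k m l x) * eta j x.
  by rewrite -!sumrB; apply: eq_bigr => j _; rewrite !mulrBl.
rewrite contract_tdelta// (contract_sum (b := fun l => tcN l k x)) => [|l]; last first.
  exact: euler_tB.
rewrite (contract_sum (b := fun=> 0)) => [|r]; last exact: conj_euler_tBb.
rewrite (contract_sum (b := fun l => tcN l h x)) => [|l]; last exact: euler_tB.
rewrite [X in _ - X - _]big1 ?subr0 => [|r _]; last by rewrite mul0r.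
have H := half_eq (spray_lowered_de_de k h m Ax).
have H' := half_eq (rund_lowered k h m Ax).
move: H H'; rewrite /tdelta.
have -> : \sum_i de h (tC i m k) x * tG i x = \sum_p tG p x * de p (tC k m h) x.
  by apply: eq_bigr => i _; rewrite mulrC tC_der_sym.
have -> : \sum_i tC i m k x * tcN i h x = \sum_l tcN l h x * tC k m l x.
  by apply: eq_bigr => i _; rewrite mulrC tC_sym.
have -> : \sum_i tC i m h x * tcN i k x = \sum_l tcN l k x * tC l m h x.
  by apply: eq_bigr => i _; rewrite mulrC.
rewrite -/(tC _ _ _).
have -> : \sum_j tcN j h x * de j (tg k m) x = \sum_l tcN l h x * tC k m l x by [].
have -> : \sum_j tcN j k x * de j (tg h m) x = \sum_l tcN l k x * tC l m h x.
  by apply: eq_bigr => i _; rewrite -/(tC h m i x) tC_sym.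
have -> : \sum_i tg i m x * (tB i k h x - trund i k h x) =
    \sum_i tg i m x * tB i k h x - \sum_i tg i m x * trund i k h x.
  by rewrite -sumrB; apply: eq_bigr => i _; rewrite mulrBr.
move: (\sum_i tg i m x * tB i k h x) (\sum_i tg i m x * trund i k h x) => P4 Q.
move: (\sum_p tG p x * de p (tC k m h) x) (\sum_l tcN l h x * tC k m l x)
  (\sum_l tcN l k x * tC l m h x) (\sum_j eta j x * dz j (tC k m h) x)
  (dz k (tg h m) x) (dz h (tg k m) x) => X2 X5 X3 X1 D1 D2 H H'.
(* Arranged so that [H] and [H'] apply; the base derivatives [D1] and [D2] of the metric then
   cancel. *)
have -> : 2 * (P4 - Q) = 2 * (X2 + X5 + (X3 + P4)) - 2 * Q - 2 * (X2 + X5 + X3).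
  by ring.
by rewrite H H'; ring.
Qed.

Lemma landsberg_iff : (forall x, A x -> forall k m h,
    \sum_j thcov3 tC k m h j x * eta j x = 0) <->
  (forall x, A x -> forall i j k, tB i j k x = trund i j k x).
Proof.
split=> [H x Ax i j k|H x Ax k m h]; last first.
  rewrite hcov3_cartan_contracted// big1 ?mulr0// => i _.
  by rewrite H// subrr mulr0.
apply: (tg_inj (a := fun i => tB i j k x) (b := fun i => trund i j k x) Ax) => m.
apply/eqP; rewrite -subr_eq0 -sumrB; apply/eqP.
have := H x Ax j m k; rewrite hcov3_cartan_contracted// => /eqP.
rewrite mulf_eq0 pnatr_eq0 /= => /eqP E; rewrite -[RHS]E.
by apply: eq_bigr => l _; rewrite mulrBr.
Qed.

(** * The barred contraction of the Cartan tensor and holomorphy of the spray *)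

Lemma spray_lowered_deb h m x : A x ->
  \sum_i deb h (tg i m) x * tG i x + \sum_i tg i m x * deb h (tG i) x =
  2^-1 * \sum_j eta j x * dz j (deb h (deb m L)) x.
Proof.
move=> Ax.
have s0 : S (fun y => \sum_i tg i m y * tG i y).
  by apply: S_sum' => i; apply: SM; [exact: S_tg|exact: S_tG].
have := der_ext (isD_deb h) (spray_lowered m) s0 Ax.
rewrite d_sumM//; [|by move=> i; exact: S_tg|exact: S_tG] => ->.
rewrite d_Z//; last by apply: S_sum' => i; apply: SM => //; exact: S_dz_debL.
rewrite d_sumM//; last by move=> i; exact: S_dz_debL.
rewrite [X in X + _]big1 ?add0r => [|j _]; last by rewrite deb_eta// mul0r.
congr (_ * _); apply: eq_bigr => j _.
by rewrite (isD_comm (isD_deb h) (isD_dz j) (S_debL m) Ax).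
Qed.

Lemma conj_deb_tg h i j x : A x -> (deb h (tg i j) x)^* = tC j i h x.
Proof.
move=> Ax; rewrite conj_deb//; last exact: S_tg.
apply: der_ext => //; last by apply: SJ; exact: S_tg.
by move=> y; exact: tg_conj.
Qed.

Lemma conj_deb_debL h m y : A y -> (deb h (deb m L) y)^* = de h (de m L) y.
Proof.
move=> Ay; rewrite conj_deb//; last exact: S_debL.
apply: der_ext => //; last by apply: SJ; exact: S_debL.
by move=> z Az; rewrite conj_deb//; apply: der_ext => //; exact: SJ.
Qed.

Lemma conj_spray_lowered_deb h j x : A x ->
  \sum_i tC j i h x * (tG i x)^* + \sum_i tg j i x * (deb h (tG i) x)^* =
  2^-1 * \sum_k (eta k x)^* * dzb k (de h (de j L)) x.
Proof.
move=> Ax; have := congr1 (fun a : K => a^*) (spray_lowered_deb h j Ax).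
rewrite rmorphD rmorphM fmorphV rmorph_nat !rmorph_sum /=.
have -> : \sum_i (deb h (tg i j) x * tG i x)^* = \sum_i tC j i h x * (tG i x)^*.
  by apply: eq_bigr => i _; rewrite rmorphM /= conj_deb_tg.
have -> : \sum_i (tg i j x * deb h (tG i) x)^* = \sum_i tg j i x * (deb h (tG i) x)^*.
  by apply: eq_bigr => i _; rewrite rmorphM /= tg_conj.
move=> ->; congr (_ * _); apply: eq_bigr => k _; rewrite rmorphM /=; congr (_ * _).
have s2 : S (deb h (deb j L)) by apply: S_der => //; exact: S_debL.
rewrite conj_dz//; apply: der_ext => //; last exact: SJ.
by move=> y; exact: conj_deb_debL.
Qed.

Lemma conj_euler_L j x : A x -> \sum_r (eta r x)^* * tg j r x = de j L x.
Proof.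
move=> Ax; have := congr1 (fun a : K => a^*) (euler_L j Ax).
rewrite conj_deb// rmorph_sum /=.
have -> : de j (fun y => (L y)^*) x = de j L x by apply: der_ext => //; exact: SJ.
move=> E; rewrite -[RHS]E; apply: eq_bigr => r _.
by rewrite rmorphM /= tg_conj.
Qed.

(** Contracting the barred index undoes the derivative [deb r] in the metric, by the conjugate Euler
    relation, and [de h] does not see the conjugate of [eta]. *)
Lemma cartan_contracted_bar j h x : A x ->
  \sum_r (eta r x)^* * tC j r h x = de h (de j L) x.
Proof.
move=> Ax; have s0 : S (fun y => \sum_r (eta r y)^* * tg j r y).
  by apply: S_sum' => r; apply: SM; [exact: SJ|exact: S_tg].
rewrite -(der_ext (isD_de h) (conj_euler_L j) s0 Ax) der_sum_conj_eta//.
  by move=> l; exact: de_conj_eta.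
by move=> i; exact: S_tg.
Qed.

(** All derivatives commute, so [p] and [r] may be exchanged; the sum is then [de h] of the barred
    Euler relation of the metric. *)
Lemma deb_cartan_contracted_bar j h p x : A x ->
  \sum_r (eta r x)^* * deb p (tC j r h) x = 0.
Proof.
move=> Ax.
have sd i k l : S (deb i (tg k l)) by apply: S_der => //; exact: S_tg.
have s0 : S (fun y => \sum_r (eta r y)^* * deb r (tg j p) y).
  by apply: S_sum' => r; apply: SM => //; exact: SJ.
have := der_ext (isD_de h) (euler_tg_bar j p) s0 Ax.
rewrite der_sum_conj_eta//; last by move=> l; exact: de_conj_eta.
rewrite (der_cst (isD_der (isD_de h)) _ Ax) => E.
rewrite -[RHS]E; apply: eq_bigr => r _.
congr (_ * _); rewrite (isD_comm (isD_deb p) (isD_de h) (S_tg j r) Ax).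
apply: der_ext => // y Ay.
rewrite (isD_comm (isD_deb p) (isD_de j) (S_debL r) Ay).
rewrite (isD_comm (isD_deb r) (isD_de j) (S_debL p) Ay).
apply: der_ext => //; last by apply: S_der => //; exact: S_debL.
by move=> z Az; exact: (isD_comm (isD_deb p) (isD_deb r) S_L Az).
Qed.

Lemma conj_euler_tG i x : A x ->
  \sum_k (eta k x)^* * (tcN i k x)^* = 2 * (tG i x)^*.
Proof.
move=> Ax; have := congr1 (fun a : K => a^*) (euler_tG i Ax).
rewrite rmorphM rmorph_nat /= => <-; rewrite rmorph_sum.
by apply: eq_bigr => k _; rewrite rmorphM.
Qed.

Lemma contract_tdeltab f x : A x -> \sum_k tdeltab k f x * (eta k x)^* =
  \sum_k (eta k x)^* * dzb k f x - \sum_p (2 * (tG p x)^*) * deb p f x.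
Proof.
move=> Ax; under eq_bigr do rewrite mulrBl; rewrite sumrB; congr (_ - _).
  by apply: eq_bigr => j _; rewrite mulrC.
apply: (contract_sum (e := fun k => (eta k x)^*) (a := fun p k => (tcN p k x)^*)) => p.
exact: conj_euler_tG.
Qed.

(** The terms in [tBb] vanish by [euler_tBb], and the vertical derivatives of the Cartan tensor by
    [deb_cartan_contracted_bar]. The remaining term in [tB] contracts to the conjugate spray, and
    [conj_spray_lowered_deb] evaluates the rest. *)
Lemma hbarcov3_cartan_contracted j h x : A x ->
  \sum_r \sum_k thbarcov3 tC j r h k x * (eta r x)^* * (eta k x)^* =
  2 * \sum_i tg j i x * (deb h (tG i) x)^*.
Proof.
move=> Ax.
have inner r : \sum_k thbarcov3 tC j r h k x * (eta r x)^* * (eta k x)^* =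
    (eta r x)^* * (\sum_k (eta k x)^* * dzb k (tC j r h) x)
    - (eta r x)^* * (\sum_p (2 * (tG p x)^*) * deb p (tC j r h) x)
    - (eta r x)^* * (\sum_m (tcN m r x)^* * tC j m h x).
  rewrite -!mulrBr -contract_tdeltab//.
  rewrite -(@contract_sum (fun k => (eta k x)^*) (fun m k => (tB m r k x)^*)
      (fun m => (tcN m r x)^*)) => [|m]; last first.
    rewrite -euler_tB// rmorph_sum; apply: eq_bigr => k _; by rewrite rmorphM.
  have z i (F : 'I_n -> K) : \sum_k (\sum_l tBb l i k x * F l) * (eta k x)^* = 0.
    rewrite (@contract_sum (fun k => (eta k x)^*) _ (fun=> 0)) => [|l].
      by rewrite big1// => l _; rewrite mul0r.
    exact: euler_tBb.
  have -> : \sum_k tdeltab k (tC j r h) x * (eta k x)^* -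
      \sum_k (\sum_m (tB m r k x)^* * tC j m h x) * (eta k x)^* =
    \sum_k tdeltab k (tC j r h) x * (eta k x)^*
    - \sum_k (\sum_l tBb l j k x * tC l r h x) * (eta k x)^*
    - \sum_k (\sum_m (tB m r k x)^* * tC j m h x) * (eta k x)^*
    - \sum_k (\sum_l tBb l h k x * tC j r l x) * (eta k x)^* by rewrite !z !subr0.
  rewrite -!sumrB mulr_sumr; apply: eq_bigr => k _.
  by rewrite -!mulrBl mulrA [X in X * _]mulrC.
under eq_bigr do rewrite inner; rewrite !sumrB.
have -> : \sum_r (eta r x)^* * (\sum_k (eta k x)^* * dzb k (tC j r h) x) =
    \sum_k (eta k x)^* * dzb k (de h (de j L)) x.
  under eq_bigr do rewrite mulr_sumr; rewrite exchange_big; apply: eq_bigr => k _.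
  have s0 : S (fun y => \sum_r (eta r y)^* * tC j r h y).
    by apply: S_sum' => r; apply: SM; [exact: SJ|exact: S_tC].
  rewrite -(der_ext (isD_dzb k) (cartan_contracted_bar j h) s0 Ax).
  rewrite der_sum_conj_eta//; last 2 first.
  - by move=> l; exact: dzb_conj_eta.
  - by move=> i; exact: S_tC.
  by rewrite mulr_sumr; apply: eq_bigr => r _; rewrite mulrCA.
have -> : \sum_r (eta r x)^* * (\sum_p (2 * (tG p x)^*) * deb p (tC j r h) x) = 0.
  under eq_bigr do rewrite mulr_sumr; rewrite exchange_big big1// => p _.
  under eq_bigr do rewrite mulrCA.
  by rewrite -mulr_sumr deb_cartan_contracted_bar// mulr0.
have -> : \sum_r (eta r x)^* * (\sum_m (tcN m r x)^* * tC j m h x) =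
    2 * \sum_i tC j i h x * (tG i x)^*.
  under eq_bigr do rewrite mulr_sumr; rewrite exchange_big mulr_sumr.
  apply: eq_bigr => m _; under eq_bigr do rewrite mulrA.
  by rewrite -mulr_suml conj_euler_tG// -mulrA [_^* * _]mulrC.
have H := half_eq (conj_spray_lowered_deb h j Ax).
by rewrite -H subr0 mulrDr addrAC subrr add0r.
Qed.

Lemma spray_holomorphic_iff : (forall x, A x -> forall j h,
    \sum_r \sum_k thbarcov3 tC j r h k x * (eta r x)^* * (eta k x)^* = 0) <->
  (forall x, A x -> forall i h, deb h (tG i) x = 0).
Proof.
split=> [H x Ax i h|H x Ax j h]; last first.
  rewrite hbarcov3_cartan_contracted// big1 ?mulr0// => i _.
  by rewrite H// conjC0 mulr0.
apply: (tg_inj (a := fun i => deb h (tG i) x) (b := fun=> 0) Ax) => m.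
rewrite [RHS]big1 => [|l _]; last by rewrite mulr0.
apply: (can_inj (@conjCK K)); rewrite conjC0.
have := H x Ax m h; rewrite hbarcov3_cartan_contracted// => /eqP.
rewrite mulf_eq0 pnatr_eq0 /= => /eqP E; rewrite -[RHS]E rmorph_sum.
by apply: eq_bigr => l _; rewrite rmorphM /= tg_conj.
Qed.

(** * Consequences of holomorphy of the spray along the fibres *)

Lemma tBb_eq0 : (forall x, A x -> forall i h, deb h (tG i) x = 0) ->
  forall x, A x -> forall i j k, tBb i j k x = 0.
Proof.
move=> H x Ax i j k; rewrite /tBb (isD_comm (isD_deb k) (isD_de j) (S_tG i) Ax).
rewrite -[RHS](der_cst (isD_der (isD_de j)) 0 Ax).
apply: der_ext => //; last by apply: S_der => //; exact: S_tG.
by move=> y Ay; exact: H.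
Qed.

Lemma tdeltab_ext k f g x : (forall y, A y -> f y = g y) -> S f -> A x ->
  tdeltab k f x = tdeltab k g x.
Proof.
move=> fg sf Ax; rewrite /tdeltab (der_ext (isD_dzb k) fg sf Ax); congr (_ - _).
by apply: eq_bigr => j _; rewrite (der_ext (isD_deb j) fg sf Ax).
Qed.

Lemma conj_tdelta k f x : S f -> A x ->
  (tdelta k f x)^* = tdeltab k (fun y => (f y)^*) x.
Proof.
move=> sf Ax; rewrite /tdelta /tdeltab rmorphB rmorph_sum /= conj_dz//.
by congr (_ - _); apply: eq_bigr => j _; rewrite rmorphM /= conj_de.
Qed.

Lemma conj_tdelta_tg k i j x : A x -> (tdelta k (tg i j) x)^* = tdeltab k (tg j i) x.
Proof.
move=> Ax; rewrite conj_tdelta//; last exact: S_tg.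
apply: tdeltab_ext => //; last by apply: SJ; exact: S_tg.
by move=> y; exact: tg_conj.
Qed.

Lemma rund_bar_lowered i j k x : A x -> \sum_m (trundb m j k x)^* * tg i m x =
  2^-1 * (tdelta k (tg i j) x - tdelta i (tg k j) x).
Proof.
move=> Ax.
have E : \sum_m tg m i x * trundb m j k x =
    2^-1 * (tdeltab k (tg j i) x - tdeltab i (tg j k) x).
  rewrite -(tg_raise (fun m => 2^-1 * (tdeltab k (tg j m) x -
    tdeltab m (tg j k) x)) i Ax).
  apply: eq_bigr => m _; congr (_ * _); rewrite /trundb mulr_sumr.
  by apply: eq_bigr => l _; rewrite mulrCA.
move: E; rewrite -!conj_tdelta_tg// => /(congr1 (fun a : K => a^*)).
rewrite rmorphM rmorphB /= !conjCK fmorphV rmorph_nat => <-.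
by rewrite rmorph_sum; apply: eq_bigr => m _; rewrite rmorphM /= tg_conj// mulrC.
Qed.

(** With a = [tdelta k (tg i j) x], b = [tdelta i (tg k j) x] and c the lowered Berwald coefficient,
    one side says a - c = (a - b) / 2 and the other c = (a + b) / 2. *)
Lemma hcov2_metric_iff : (forall x, A x -> forall i h, deb h (tG i) x = 0) ->
  (forall x, A x -> forall i j k,
    thcov2 tg i j k x = \sum_m (trundb m j k x)^* * tg i m x) <->
  (forall x, A x -> forall i j k, tB i j k x = trund i j k x).
Proof.
move=> hol.
have E x i j k : A x -> thcov2 tg i j k x =
    tdelta k (tg i j) x - \sum_l tB l i k x * tg l j x.
  move=> Ax; rewrite /thcov2 [X in _ - X]big1 ?subr0// => m _.
  by rewrite tBb_eq0// conjC0 mul0r.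
have half (a b c : K) : (a - c == 2^-1 * (a - b)) = (c == 2^-1 * (a + b)).
  rewrite -subr_eq0 -[RHS]subr_eq0 -[in RHS]oppr_eq0; congr (_ == _).
  have : (2 : K)^-1 * 2 = 1 by rewrite mulVf// pnatr_eq0.
  move: (2^-1 : K) => e e2; rewrite -[X in X - c]mul1r -e2; ring.
split=> [H x Ax i j k|H x Ax i j k].
  apply: (tg_inj (a := fun i => tB i j k x) (b := fun i => trund i j k x) Ax) => m.
  rewrite rund_lowered//; apply/eqP; rewrite -half -rund_bar_lowered// -H// E//.
  by apply/eqP; congr (_ - _); apply: eq_bigr => l _; rewrite mulrC.
rewrite E// rund_bar_lowered//; apply/eqP; rewrite half -rund_lowered//; apply/eqP.
by apply: eq_bigr => l _; rewrite mulrC H.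
Qed.

Lemma deb_tB_eq0 : (forall x, A x -> forall i h, deb h (tG i) x = 0) ->
  forall x, A x -> forall i j k h, deb h (tB i j k) x = 0.
Proof.
move=> H x Ax i j k h; rewrite /tB (isD_comm (isD_deb h) (isD_de k) (S_tcN i j) Ax).
rewrite -[RHS](der_cst (isD_der (isD_de k)) 0 Ax).
apply: der_ext => //; last by apply: S_der => //; exact: S_tcN.
by move=> y Ay; exact: tBb_eq0.
Qed.

Lemma spray_of_berwald i x : A x ->
  2 * tG i x = \sum_j eta j x * (\sum_k eta k x * tB i j k x).
Proof.
move=> Ax; rewrite -euler_tG//; apply: eq_bigr => j _; congr (_ * _).
by rewrite euler_tB.
Qed.

(** By [spray_of_berwald] the spray is a quadratic form in [eta] with the Berwald coefficients, and
    [eta] is itself holomorphic. *)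
Lemma spray_holomorphic_of_berwald :
  (forall x, A x -> forall i j k h, deb h (tB i j k) x = 0) ->
  forall x, A x -> forall i h, deb h (tG i) x = 0.
Proof.
move=> H x Ax i h.
have s1 j : S (fun x => \sum_k eta k x * tB i j k x).
  by apply: S_sum' => k; apply: SM => //; exact: S_tB.
have s2 : S (fun x => \sum_j eta j x * (\sum_k eta k x * tB i j k x)).
  by apply: S_sum' => j; exact: SM.
have D (F : 'I_n -> T -> K) : (forall j, S (F j)) -> (forall j, deb h (F j) x = 0) ->
    deb h (fun y => \sum_j eta j y * F j y) x = 0.
  move=> sF F0; rewrite d_sumM// !big1 ?addr0// => j _.
    by rewrite F0 mulr0.
  by rewrite deb_eta// mul0r.
have E : deb h (fun y => 2 * tG i y) x = 0.
  rewrite (der_ext (isD_deb h) (spray_of_berwald i) _ Ax); last first.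
    by apply: SM => //; exact: S_tG.
  by apply: (D _ s1) => j; apply: (D _ (S_tB i j)) => k; exact: H.
move: E; rewrite d_Z//; last exact: S_tG.
by move/eqP; rewrite mulf_eq0 pnatr_eq0 => /eqP.
Qed.

(** * Skew symmetry of the covariant derivatives of the Cartan tensor *)

Lemma de_tdelta h k f x : S f -> A x -> de h (tdelta k f) x =
  tdelta k (de h f) x - \sum_p tB p k h x * de p f x.
Proof.
move=> sf Ax; have sd p : S (de p f) by exact: S_der.
have sz : S (dz k f) by exact: S_der.
have ss : S (fun y => \sum_p tcN p k y * de p f y).
  by apply: S_sum' => p; apply: SM => //; exact: S_tcN.
rewrite /tdelta d_B// d_sumM//; last by move=> p; exact: S_tcN.
(* The commutator consists of the terms where [de h] falls on [tcN p k], which produces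
   [tB p k h]. *)
rewrite (isD_comm (isD_de h) (isD_dz k) sf Ax) opprD addrA addrAC.
congr (_ - _ - _); apply: eq_bigr => p _.
by rewrite (isD_comm (isD_de h) (isD_de p) sf Ax).
Qed.

(** The commutator would involve [de h] of the conjugate of [tcN p k], that is the conjugate of
    [tBb p k h]. *)
Lemma de_tdeltab h k f x : S f -> A x -> (forall p, tBb p k h x = 0) ->
  de h (tdeltab k f) x = tdeltab k (de h f) x.
Proof.
move=> sf Ax Bb0; have sd p : S (deb p f) by exact: S_der.
have sz : S (dzb k f) by exact: S_der.
have ss : S (fun y => \sum_p (tcN p k y)^* * deb p f y).
  by apply: S_sum' => p; apply: SM => //; apply: SJ; exact: S_tcN.
rewrite /tdeltab d_B// d_sumM//; last by move=> p; apply: SJ; exact: S_tcN.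
rewrite (isD_comm (isD_de h) (isD_dzb k) sf Ax) [X in _ - (X + _)]big1 ?add0r.
  congr (_ - _); apply: eq_bigr => p _.
  by rewrite (isD_comm (isD_de h) (isD_deb p) sf Ax).
move=> p _; rewrite -conj_deb; [|exact: S_tcN|by []].
by rewrite -/(tBb p k h x) Bb0 conjC0 mul0r.
Qed.

Lemma S_tdeltab k f : S f -> S (tdeltab k f).
Proof.
move=> sf; apply: SD; first exact: S_der.
apply: (S_opp S_cst SM S_eq); apply: S_sum' => j.
by apply: SM; [apply: SJ; exact: S_tcN|exact: S_der].
Qed.

(** After differentiation, the product rule supplies the connection terms of the indices [j] and
    [k], equal by symmetry of [tB], and [de_tdelta] those of [h]; the barred terms vanish by
    holomorphy. *)
Lemma hcov3_cartan_skew :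
  (forall x, A x -> forall i j k, tB i j k x = trund i j k x) ->
  (forall x, A x -> forall i h, deb h (tG i) x = 0) ->
  (forall x, A x -> forall i j k h, de h (tB i j k) x = 0) ->
  forall x, A x -> forall j m h k, thcov3 tC j m h k x + thcov3 tC k m h j x = 0.
Proof.
move=> lands hol dB x Ax j m h k.
have E y : A y -> \sum_i tg i m y * tB i j k y =
    2^-1 * (tdelta k (tg j m) y + tdelta j (tg k m) y).
  by move=> Ay; rewrite -rund_lowered//; apply: eq_bigr => i _; rewrite lands.
have s0 : S (fun y => \sum_i tg i m y * tB i j k y).
  by apply: S_sum' => i; apply: SM; [exact: S_tg|exact: S_tB].
have sd i l p : S (tdelta i (tg l p)) by apply: S_tdelta; exact: S_tg.
have := der_ext (isD_de h) E s0 Ax.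
rewrite d_Z//; last exact: SD.
rewrite (derD (isD_der (isD_de h)))// !de_tdelta//; [|exact: S_tg|exact: S_tg].
rewrite d_sumM//; [|by move=> i; exact: S_tg|by move=> i; exact: S_tB].
rewrite [X in _ + X]big1 ?addr0 => [|i _]; last by rewrite dB// mulr0.
rewrite -/(tC j m h) -/(tC k m h) => /half_eq H.
have Bb0 (F : 'I_n -> K) i : \sum_r (tBb r m i x)^* * F r = 0.
  by rewrite big1// => r _; rewrite tBb_eq0// conjC0 mul0r.
rewrite /thcov3 !Bb0 !subr0.
have -> : \sum_l tB l k j x * tC l m h x = \sum_i de h (tg i m) x * tB i j k x.
  by apply: eq_bigr => l _; rewrite mulrC tB_sym.
have -> : \sum_l tB l j k x * tC l m h x = \sum_i de h (tg i m) x * tB i j k x.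
  by apply: eq_bigr => l _; rewrite mulrC.
have -> : \sum_l tB l h k x * tC j m l x = \sum_p tB p k h x * de p (tg j m) x.
  by apply: eq_bigr => l _; rewrite tB_sym.
have -> : \sum_l tB l h j x * tC k m l x = \sum_p tB p j h x * de p (tg k m) x.
  by apply: eq_bigr => l _; rewrite tB_sym.
move: H; set X := \sum_i _; set Y := \sum_p _; set Z := \sum_p _ => H.
have -> : forall a b : K, a - X - Y + (b - X - Z) = (a - Y + (b - Z)) - 2 * X.
  by move=> a b; ring.
by rewrite H subrr.
Qed.

Lemma hbarcov3_cartan_skew :
  (forall x, A x -> forall i j k, tB i j k x = trund i j k x) ->
  (forall x, A x -> forall i h, deb h (tG i) x = 0) ->
  forall x, A x -> forall r l h k,
  thbarcov3 tC r l h k x + thbarcov3 tC r k h l x = 0.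
Proof.
move=> lands hol x Ax r l h k.
have Bb0 i j k' : tBb i j k' x = 0 by exact: tBb_eq0.
have E y : A y -> \sum_i tg r i y * (tB i l k y)^* =
    2^-1 * (tdeltab k (tg r l) y + tdeltab l (tg r k) y).
  move=> Ay; have := congr1 (fun a : K => a^*) (rund_lowered l k r Ay).
  rewrite rmorphM rmorphD /= !conj_tdelta_tg// fmorphV rmorph_nat => <-.
  rewrite rmorph_sum; apply: eq_bigr => i _.
  by rewrite rmorphM /= tg_conj// lands.
have sB i : S (fun y => (tB i l k y)^*) by apply: SJ; exact: S_tB.
have s0 : S (fun y => \sum_i tg r i y * (tB i l k y)^*).
  by apply: S_sum' => i; apply: SM => //; exact: S_tg.
have sd i j p : S (tdeltab i (tg j p)) by apply: S_tdeltab; exact: S_tg.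
have := der_ext (isD_de h) E s0 Ax.
rewrite d_Z//; last exact: SD.
rewrite (derD (isD_der (isD_de h)))// !de_tdeltab//; [|exact: S_tg|exact: S_tg].
rewrite d_sumM//; last by move=> i; exact: S_tg.
(* The derivative of the conjugate of [tB] along [eta] is the conjugate of [deb h] of [tB], which is
   zero by holomorphy. *)
rewrite [X in _ + X]big1 ?addr0 => [|i _]; last first.
  rewrite -conj_deb//; last exact: S_tB.
  by rewrite deb_tB_eq0// conjC0 mulr0.
rewrite -/(tC r l h) -/(tC r k h) => /half_eq H.
have z (F : 'I_n -> K) i j : \sum_p tBb p i j x * F p = 0.
  by rewrite big1// => p _; rewrite Bb0 mul0r.
rewrite /thbarcov3 !z !subr0.
have -> : \sum_m (tB m l k x)^* * tC r m h x = \sum_i de h (tg r i) x * (tB i l k x)^*.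
  by apply: eq_bigr => m _; rewrite mulrC.
have -> : \sum_m (tB m k l x)^* * tC r m h x = \sum_i de h (tg r i) x * (tB i l k x)^*.
  by apply: eq_bigr => m _; rewrite mulrC tB_sym.
move: H; set X := \sum_i _ => H.
have -> : forall a b : K, a - X + (b - X) = (a + b) - 2 * X by move=> a b; ring.
by rewrite H subrr.
Qed.

(** Contract the skew relation with [eta k]. The second term vanishes because [eta k] annihilates
    the first index of the Cartan tensor, and this survives covariant differentiation. *)
Lemma hcov3_contracted_of_skew :
  (forall x, A x -> forall j r h k, thcov3 tC j r h k x + thcov3 tC k r h j x = 0) ->
  forall x, A x -> forall j r h, \sum_k thcov3 tC j r h k x * eta k x = 0.
Proof.
move=> skew x Ax j r h.
have e0 r' : \sum_k eta k x * tC k r' h x = 0.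
  by rewrite -[RHS](euler_tg h r' Ax); apply: eq_bigr => k _; rewrite tC_sym.
have s0 : S (fun y => \sum_k eta k y * tC k r h y).
  by apply: S_sum' => k; apply: SM => //; exact: S_tC.
have e0' y : A y -> \sum_k eta k y * tC k r h y = 0.
  by move=> Ay; rewrite -[RHS](euler_tg h r Ay); apply: eq_bigr => k _; rewrite tC_sym.
have e1 : \sum_k eta k x * dz j (tC k r h) x = 0.
  have := der_ext (isD_dz j) e0' s0 Ax; rewrite (der_cst (isD_der (isD_dz j)) _ Ax).
  rewrite d_sumM//; last by move=> k; exact: S_tC.
  by rewrite [X in X + _]big1 ?add0r// => l _; rewrite dz_eta// mul0r.
have e2 p : \sum_k eta k x * de p (tC k r h) x = - tC p r h x.
  have := der_ext (isD_de p) e0' s0 Ax; rewrite (der_cst (isD_der (isD_de p)) _ Ax).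
  rewrite de_sum_eta//; last by move=> k; exact: S_tC.
  by move/eqP; rewrite addrC addr_eq0 => /eqP.
(* Here [eta] is not constant under [tdelta]; the resulting term is exactly the contracted Berwald
   term of the first index. *)
have e3 : \sum_k tdelta j (tC k r h) x * eta k x = \sum_p tcN p j x * tC p r h x.
  under eq_bigr do rewrite mulrBl mulrC; rewrite sumrB e1 sub0r.
  under eq_bigr do rewrite mulr_suml.
  rewrite exchange_big -sumrN; apply: eq_bigr => p _.
  rewrite -[tC p r h x]opprK -e2 mulrN mulr_sumr; congr (- _).
  by apply: eq_bigr => k _; rewrite mulrAC mulrA.
have : \sum_k thcov3 tC k r h j x * eta k x = 0.
  have -> : \sum_k thcov3 tC k r h j x * eta k x =
      \sum_k tdelta j (tC k r h) x * eta k x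
      - \sum_k (\sum_l tB l k j x * tC l r h x) * eta k x
      - \sum_k (\sum_m (tBb m r j x)^* * tC k m h x) * eta k x
      - \sum_k (\sum_l tB l h j x * tC k r l x) * eta k x.
    by rewrite -!sumrB; apply: eq_bigr => k _; rewrite !mulrBl.
  rewrite e3 (contract_sum (b := fun l => tcN l j x)) => [|l]; last exact: euler_tB'.
  rewrite subrr sub0r.
  have z (a : 'I_n -> K) (F : 'I_n -> 'I_n -> K) :
      (forall m, \sum_k eta k x * F k m = 0) ->
      \sum_k (\sum_m a m * F k m) * eta k x = 0.
    move=> F0; under eq_bigr do rewrite mulr_suml.
    rewrite exchange_big big1// => m _.
    under eq_bigr do rewrite -mulrA [X in _ * X]mulrC.
    by rewrite -mulr_sumr F0 mulr0.
  rewrite !z ?subr0 ?oppr0// => m.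
  by rewrite -[RHS](euler_tg m r Ax); apply: eq_bigr => k _; rewrite tC_sym.
move=> E; have -> : \sum_k thcov3 tC j r h k x * eta k x =
    \sum_k thcov3 tC j r h k x * eta k x + \sum_k thcov3 tC k r h j x * eta k x.
  by rewrite E addr0.
rewrite -big_split big1// => k _ /=.
by rewrite -mulrDl skew// mul0r.
Qed.

(** A skew expression is contracted with a symmetric product, so the sum equals its own negative. *)
Lemma hbarcov3_contracted_of_skew :
  (forall x, A x -> forall r l h k,
    thbarcov3 tC r l h k x + thbarcov3 tC r k h l x = 0) ->
  forall x, A x -> forall j h,
  \sum_r \sum_k thbarcov3 tC j r h k x * (eta r x)^* * (eta k x)^* = 0.
Proof.
move=> skew x Ax j h; set X := \sum_r _.
have E : X = \sum_r \sum_k thbarcov3 tC j k h r x * (eta r x)^* * (eta k x)^*.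
  rewrite /X exchange_big; apply: eq_bigr => r _; apply: eq_bigr => k _.
  by rewrite mulrAC.
have : X + X = 0.
  rewrite {2}E /X -big_split big1// => r _; rewrite -big_split big1// => k _ /=.
  by rewrite -!mulrDl skew// !mul0r.
by move/eqP; rewrite -mulr2n mulrn_eq0 => /eqP.
Qed.

End SprayCalculus.

(** * Homogeneity along the fibres *)

Lemma cancel_factor (K : fieldType) (l c a b : K) : l != 0 ->
  l * a = c * b -> a = l^-1 * c * b.
Proof. by move=> l0 E; rewrite -mulrA -E mulKf. Qed.

Lemma half_sub_ii (K : numClosedFieldType) (a b : K) :
  2^-1 * (a * b - 'i * (a * 'i * b)) = a * b.
Proof.
have -> : 'i * (a * 'i * b) = 'i ^+ 2 * (a * b) by rewrite expr2; ring.
by rewrite sqrCi mulN1r opprK -mulr2n -[X in _ * X]mulr_natl mulKf// pnatr_eq0.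
Qed.

Lemma half_add_ii (K : numClosedFieldType) (a b : K) :
  2^-1 * (a * b + 'i * (a * 'i * b)) = 0.
Proof.
have -> : 'i * (a * 'i * b) = 'i ^+ 2 * (a * b) by rewrite expr2; ring.
by rewrite sqrCi mulN1r subrr mulr0.
Qed.

Section FiberScaling.
Variables (R : realType) (n : nat).
Local Notation C := (Cplx R).
Local Notation V := ('rV[C]_n * 'rV[C]_n)%type.
Implicit Types (f g : V -> C) (v w x : V) (a b c d lam mu : C).

Definition fiber_scale lam x : V := (x.1, lam *: x.2).

Lemma fiber_scale_line lam v x t :
  line (fiber_scale lam v) (fiber_scale lam x) t = fiber_scale lam (line v x t).
Proof.
rewrite /line /fiber_scale; congr (_, _) => /=.
by rewrite scalerDr !scalerA mulrC.
Qed.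

Lemma fiber_scale_Z lam a v : a *: fiber_scale lam v = fiber_scale lam (a *: v).
Proof.
by rewrite /fiber_scale; congr (_, _) => /=; rewrite !scalerA mulrC.
Qed.

Lemma rderive_fiber_scale f lam v x :
  rderive f (fiber_scale lam v) (fiber_scale lam x) =
  rderive (f \o fiber_scale lam) v x.
Proof.
by apply: rderive_line_eq => t; rewrite fiber_scale_line.
Qed.

Variable A : set V.
Hypothesis oA : open A.
Local Notation smooth := (smooth_on A).

Definition scales lam c f := forall x, A x -> f (fiber_scale lam x) = c * f x.

Lemma rderive_scales lam c f v x : scales lam c f -> smooth f -> A x ->
  rderive f (fiber_scale lam v) (fiber_scale lam x) = c * rderive f v x.
Proof.
move=> fc sf Ax; rewrite rderive_fiber_scale -(rderiveZ c v sf Ax).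
apply/esym/(rderive_eq oA) => //; last exact: smoothZ.
by move=> y Ay; rewrite /= fc.
Qed.

Lemma wirtinger_scales lam c f v x : scales lam c f -> smooth f -> A x ->
  wirtinger (fiber_scale lam v) f (fiber_scale lam x) = c * wirtinger v f x.
Proof.
move=> fc sf Ax; rewrite /wirtinger fiber_scale_Z.
rewrite (rderive_scales v fc sf Ax) (rderive_scales ('i *: v) fc sf Ax).
by rewrite [in LHS]mulrCA -mulrBr mulrCA.
Qed.

Lemma wirtinger_bar_scales lam c f v x : scales lam c f -> smooth f -> A x ->
  wirtinger_bar (fiber_scale lam v) f (fiber_scale lam x) = c * wirtinger_bar v f x.
Proof.
move=> fc sf Ax; rewrite /wirtinger_bar fiber_scale_Z.
rewrite (rderive_scales v fc sf Ax) (rderive_scales ('i *: v) fc sf Ax).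
by rewrite [in LHS]mulrCA -mulrDr mulrCA.
Qed.

Lemma fiber_scale_base lam (u : 'rV[C]_n) : fiber_scale lam (u, 0) = (u, 0).
Proof. by rewrite /fiber_scale scaler0. Qed.

Lemma fiber_scale_fiber lam (u : 'rV[C]_n) :
  fiber_scale lam (0, u) = lam *: ((0, u) : V).
Proof. by rewrite /fiber_scale; congr (_, _); rewrite /= scaler0. Qed.

Lemma dz_scales lam c f k : scales lam c f -> smooth f -> scales lam c (dz k f).
Proof.
move=> fc sf x Ax.
by rewrite /dz -{1}(fiber_scale_base lam) (wirtinger_scales _ fc sf Ax).
Qed.

Hypothesis A_scale : forall lam x, lam != 0 -> A x -> A (fiber_scale lam x).

(** Scaling multiplies a fibre direction by [lam], which [wirtinger] releases as the factor [lam];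
    for [detabar] the factor is its conjugate. *)
Lemma deta_scales lam c f k : lam != 0 -> scales lam c f -> smooth f ->
  scales lam (lam^-1 * c) (deta k f).
Proof.
move=> lam0 fc sf x Ax; apply: (cancel_factor lam0).
have := wirtinger_scales (0, delta_mx 0 k) fc sf Ax.
by rewrite fiber_scale_fiber (wirtinger_dirZ oA _ _ sf (A_scale lam0 Ax)).
Qed.

Lemma detabar_scales lam c f k : lam != 0 -> scales lam c f -> smooth f ->
  scales lam (lam^*^-1 * c) (detabar k f).
Proof.
move=> lam0 fc sf x Ax; have lam0' : lam^* != 0 by rewrite conjC_eq0.
apply: (cancel_factor lam0').
have := wirtinger_bar_scales (0, delta_mx 0 k) fc sf Ax.
by rewrite fiber_scale_fiber (wirtinger_bar_dirZ oA _ _ sf (A_scale lam0 Ax)).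
Qed.

(** Stated for quadratic polynomials so as to cover the degrees 0, 1 and 2 of homogeneity at
    once. *)
Lemma is_rderive_quadratic f v x b d :
  (\forall t \near (0 : R), f (line v x t) = f x + (t%:C)%C * b + (t%:C)%C ^+ 2 * d) ->
  is_rderive f v x b.
Proof.
have E (p q r : R) : is_derive (0 : R) 1 (fun t => p + t * q + t ^+ 2 * r) q.
  have := is_deriveD (is_deriveD (is_derive_cst p (0 : R) 1)
    (is_deriveM (is_derive_id (0 : R) 1) (is_derive_cst q (0 : R) 1)))
    (is_deriveM (is_deriveX 2 (is_derive_id (0 : R) 1)) (is_derive_cst r (0 : R) 1)).
  by move=> /is_derive_eq; apply; rewrite /cst /GRing.scale /=; ring.
move=> fE; split.
  apply: near_eq_is_derive (E (complex.Re (f x)) _ (complex.Re d)).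
  near=> t; rewrite re_lineE (near fE t)// expr2.
  by rewrite !(CReD, CReM, CImM) /=; ring.
apply: near_eq_is_derive (E (complex.Im (f x)) _ (complex.Im d)).
near=> t; rewrite im_lineE (near fE t)// expr2.
by rewrite !(CImD, CReM, CImM) /=; ring.
Unshelve. all: by end_near. Qed.

Lemma near_line v x : A x -> \forall t \near (0 : R), A (line v x t).
Proof.
move=> Ax; have := @line_continuous R V v x 0; rewrite /continuous_at line0; apply.
exact: open_nbhs_nbhs.
Qed.

(** No conjugate of [lam] occurs: such a function is holomorphic on each punctured complex line
    through the origin of a fibre, which gives both Euler relations. *)
Definition degree p f := forall lam, lam != 0 -> scales lam (lam ^+ p) f.

Hypothesis A_slit : forall x, A x -> x.2 != 0.

(** Moving in direction [c *: x.2] scales the fibre coordinate by [1 + t c], so [f] becomes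
    [(1 + t c) ^+ p] times its value at [x]. *)
Lemma rderive_degree p f c x : (p <= 2)%N -> degree p f -> A x ->
  rderive f (0, c *: x.2) x = p%:R * c * f x.
Proof.
move=> p2 fp Ax; apply: is_rderiveE.
apply: (@is_rderive_quadratic _ _ _ _ ((p == 2%N)%:R * c ^+ 2 * f x)).
near=> t.
have lE : line (0, c *: x.2) x t = fiber_scale (1 + (t%:C)%C * c) x.
  rewrite /line /fiber_scale; case: (x) => z e; congr (_, _) => /=.
    by rewrite scaler0 addr0.
  by rewrite scalerDl scale1r scalerA.
have At : A (line (0, c *: x.2) x t) by near: t; exact: near_line.
have nz : 1 + (t%:C)%C * c != 0.
  by apply: contra_neq (A_slit At) => E; rewrite lE /= E scale0r.
rewrite lE fp//; move: ((t%:C)%C : C) => s.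
by case: p p2 {fp} => [|[|[|]]]//= _; ring.
Unshelve. all: by end_near. Qed.

Lemma fiber_vectorE (u : 'rV[C]_n) :
  (0, u) = \sum_k u 0 k *: ((0, delta_mx 0 k) : V) :> V.
Proof.
rewrite {1}(row_sum_delta u).
apply: (big_ind2 (fun (a : 'rV[C]_n) (b : V) => (0, a) = b)) => //.
  by move=> a1 b1 a2 b2 <- <-; congr (_, _); rewrite /= addr0.
by move=> k _; congr (_, _); rewrite /= scaler0.
Qed.

Lemma wirtinger_fiber_sum f x : smooth f -> A x ->
  wirtinger (0, x.2) f x = \sum_k x.2 0 k * deta k f x.
Proof.
move=> sf Ax.
rewrite fiber_vectorE (wirtinger_dir_sum oA)//; apply: eq_bigr => k _.
by rewrite (wirtinger_dirZ oA).
Qed.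

Lemma wirtinger_bar_fiber_sum f (u : 'rV[C]_n) x : smooth f -> A x ->
  wirtinger_bar (0, u) f x = \sum_k (u 0 k)^* * detabar k f x.
Proof.
move=> sf Ax.
rewrite fiber_vectorE (wirtinger_bar_dir_sum oA)//; apply: eq_bigr => k _.
by rewrite (wirtinger_bar_dirZ oA).
Qed.

(** The derivatives along [x.2] and ['i *: x.2] differ by the factor ['i], so they add up in
    [wirtinger] and cancel in [wirtinger_bar]. *)
Lemma euler p f x : (p <= 2)%N -> degree p f -> smooth f -> A x ->
  \sum_k x.2 0 k * deta k f x = p%:R * f x.
Proof.
move=> p2 fp sf Ax; rewrite -wirtinger_fiber_sum// /wirtinger.
have -> : 'i *: ((0, x.2) : V) = (0, 'i *: x.2) by congr (_, _); rewrite /= scaler0.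
have := rderive_degree 1 p2 fp Ax; rewrite scale1r mulr1 => ->.
rewrite (rderive_degree 'i p2 fp Ax); exact: half_sub_ii.
Qed.

Lemma euler_bar p f x : (p <= 2)%N -> degree p f -> smooth f -> A x ->
  \sum_k (x.2 0 k)^* * detabar k f x = 0.
Proof.
move=> p2 fp sf Ax; rewrite -wirtinger_bar_fiber_sum// /wirtinger_bar.
have -> : 'i *: ((0, x.2) : V) = (0, 'i *: x.2) by congr (_, _); rewrite /= scaler0.
have := rderive_degree 1 p2 fp Ax; rewrite scale1r mulr1 => ->.
rewrite (rderive_degree 'i p2 fp Ax); exact: half_add_ii.
Qed.

End FiberScaling.

(** * Liouville's theorem on the fibres *)

Lemma plane_bounded (R : realType) (U : R -> R -> R) :
  continuous (fun p : R * R => U p.1 p.2) ->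
  exists M, forall x y, `|x| <= 1 -> `|y| <= 1 -> U x y <= M.
Proof.
move=> cU; pose I := `[(-1 : R), 1]%classic.
have II x : I x = (`|x| <= 1) :> Prop by rewrite /I /= in_itv /= ler_norml.
have cI : compact (I `*` I) by apply: compact_setX; exact: segment_compact.
have I0 : (I `*` I) (0, 0) by split; rewrite /= II normr0.
have [c _ cmax] := compact_EVT_max (ex_intro _ _ I0) cI (continuous_subspaceT cU).
exists (U c.1 c.2) => x y x1 y1; apply: (cmax (x, y)).
by apply: mem_set; split; rewrite /= II.
Qed.

Section FiberLiouville.
Variables (R : realType) (n : nat).
Local Notation C := (Cplx R).
Local Notation V := ('rV[C]_n * 'rV[C]_n)%type.
Variable A : set V.
Hypothesis oA : open A.
Hypothesis A_fiber : forall z e e', A (z, e) -> e' != 0 -> A (z, e').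
Implicit Types (f : V -> C) (z e w : 'rV[C]_n) (x y : R).
Local Notation smooth := (smooth_on A).

(** The complex line through [e] in direction [w], written as two nested real lines so that real
    directional derivatives apply. *)
Definition plane z e w x y : V :=
  line ('i *: ((0, w) : V)) (line (0, w) (z, e) x) y.

Lemma planeE z e w x y :
  plane z e w x y = (z, e + ((x%:C)%C + (y%:C)%C * 'i : C) *: w).
Proof.
rewrite /plane /line; congr (_, _) => /=; first by rewrite !scaler0 !addr0.
by rewrite scalerDl -scalerA addrA.
Qed.

(** The Cauchy-Riemann equation in any fibre direction, from the coordinate ones by conjugate
    linearity of [wirtinger_bar]. *)
Lemma holomorphic_rderive f w u : smooth f -> A u ->
  (forall k, detabar k f u = 0) ->
  rderive f ('i *: ((0, w) : V)) u = 'i * rderive f (0, w) u.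
Proof.
move=> sf Au f0.
have := @wirtinger_bar_fiber_sum R n A oA f w u sf Au.
rewrite big1 => [|k _]; last by rewrite f0 mulr0.
rewrite /wirtinger_bar => /eqP; rewrite mulf_eq0 invr_eq0 pnatr_eq0 /= => /eqP.
move: (rderive _ _ _) (rderive _ _ _) => p q pq.
have := congr1 (fun a => 'i * a) pq; rewrite mulr0 mulrDr mulrA -expr2 sqrCi mulN1r.
by move/eqP; rewrite subr_eq0 => /eqP.
Qed.

Variable f : V -> C.
Hypothesis sf : smooth f.
Hypothesis f_holo : forall k u, A u -> detabar k f u = 0.
Hypothesis f_deg : forall lam, lam != 0 -> scales A lam 1 f.

(** On the unit square of parameters compactness gives a bound. Outside it, homogeneity replaces
    [e + c w] by [w + c^-1 e], whose parameter lies in the unit square. *)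
Lemma plane_Re_bounded z e w : A (z, e) -> w != 0 -> (forall c, e + c *: w != 0) ->
  exists M, forall x y, complex.Re (f (plane z e w x y)) <= M.
Proof.
move=> Aze w0 ew0.
have we0 c : w + c *: e != 0.
  have [->|c0] := eqVneq c 0; first by rewrite scale0r addr0.
  have := ew0 c^-1; apply: contra_neq => E.
  by apply: (scalerI c0); rewrite scalerDr scalerA divff// scale1r addrC E scaler0.
have cont e' w' : e' != 0 -> (forall c, e' + c *: w' != 0) ->
    continuous (fun p : R * R => complex.Re (f (plane z e' w' p.1 p.2))).
  move=> e'0 H p.
  apply: (@continuous_comp _ _ _ (fun p : R * R => f (plane z e' w' p.1 p.2))
    (@complex.Re R : C -> R)); last exact: Re_continuous.
  apply: (@continuous_comp _ _ _ (fun p : R * R => plane z e' w' p.1 p.2) f).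
    exact: plane_continuous.
  apply: (smooth_continuous sf); rewrite planeE; exact: A_fiber Aze _.
have e0 : e != 0 by have := ew0 0; rewrite scale0r addr0.
have [M HM] := plane_bounded
  (U := fun x y => complex.Re (f (plane z e w x y))) (cont e w e0 ew0).
have [M' HM'] := plane_bounded
  (U := fun x y => complex.Re (f (plane z w e x y))) (cont w e w0 we0).
exists (Num.max M M') => x y; rewrite le_max.
have [/andP[x1 y1]|xy1] := boolP ((`|x| <= 1) && (`|y| <= 1)); first by rewrite HM.
apply/orP; right; pose q := x ^+ 2 + y ^+ 2.
have sq (t : R) : `|t| ^+ 2 = t ^+ 2 by rewrite real_normK ?num_real.
have q1 : 1 < q.
  move: xy1; rewrite negb_and -!ltNge /q -(sq x) -(sq y).
  have := sqr_ge0 `|x|; have := sqr_ge0 `|y|.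
  by move: (`|x|) (`|y|) => s t ? ? /orP[]; nra.
have q0 : 0 < q by rewrite (lt_trans ltr01).
have le_q t : t ^+ 2 <= q -> `|t / q| <= 1.
  move=> tq; rewrite normrM normfV (gtr0_norm q0) ler_pdivrMr// mul1r.
  have [t1|t1] := leP `|t| 1; first by rewrite (le_trans t1)// ltW.
  by rewrite (le_trans _ tq)// -sq; nra.
have xq : x ^+ 2 <= q by rewrite lerDl sqr_ge0.
have yq : y ^+ 2 <= q by rewrite lerDr sqr_ge0.
have := HM' (x / q) (- (y / q)) (le_q x xq); rewrite normrN => /(_ (le_q y yq)).
apply: le_trans; rewrite !planeE le_eqVlt; apply/orP; left.
apply/eqP; congr (complex.Re _).
set c := ((x%:C)%C + (y%:C)%C * 'i : C).
(* The coordinates of the inverse of [x + i y], [q] being its squared modulus. *)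
have cV : ((x / q)%:C)%C + ((- (y / q))%:C)%C * 'i = c^-1 :> C.
  apply: Ceq; rewrite ?CReV ?CImV /c !(CReD, CImD, CReM, CImM, CRei, CImi) /=.
    by rewrite !(mulr0, mulr1, mul0r, subr0, addr0, add0r, subrr).
  by rewrite !(mulr0, mulr1, mul0r, subr0, addr0, add0r, subrr).
have c0 : c != 0.
  apply: contraTneq q1 => c0; have := congr1 (@complex.Re R) c0.
  have := congr1 (@complex.Im R) c0.
  rewrite /c !(CReD, CImD, CReM, CImM, CRei, CImi) /=.
  rewrite !(mulr0, mulr1, mul0r, subr0, addr0, add0r) => y0 x0.
  by rewrite /q x0 y0 expr0n addr0 ltr10.
rewrite cV; set u : V := (z, w + c^-1 *: e).
have -> : (z, e + c *: w) = fiber_scale c u.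
  rewrite /fiber_scale /u; congr (_, _) => /=.
  by rewrite scalerDr scalerA divff// scale1r addrC.
by rewrite f_deg// ?mul1r//; apply: A_fiber Aze _; exact: we0.
Qed.

(** By the Cauchy-Riemann equation the second derivative along [iv] is minus the one along [v], so
    the real part is a bounded harmonic function on the plane. *)
Lemma plane_Re_le z e w x y : A (z, e) -> w != 0 -> (forall c, e + c *: w != 0) ->
  complex.Re (f (plane z e w x y)) <= complex.Re (f (z, e)).
Proof.
move=> Aze w0 ew0; have [M HM] := plane_Re_bounded Aze w0 ew0.
have Ap s t : A (plane z e w s t) by rewrite planeE; exact: A_fiber Aze _.
pose v : V := (0, w); pose iv : V := 'i *: v.
have sv u := smooth_rderive u sf.
have dl h u p t : smooth h -> A (line u p t) ->
    is_derive t (1 : R) (fun t => complex.Re (h (line u p t)))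
      (complex.Re (rderive h u (line u p t))).
  move=> sh Apt.
  by have [] := is_rderive_line (smooth_is_rderive u sh Apt).
have dx h s t : smooth h ->
    is_derive s (1 : R) (fun s => complex.Re (h (plane z e w s t)))
      (complex.Re (rderive h v (plane z e w s t))).
  move=> sh; have E s' : plane z e w s' t = line v (line iv (z, e) t) s'.
    exact: lineC.
  rewrite E (_ : (fun s => _) = (fun s => complex.Re (h (line v (line iv (z, e) t) s)))).
    by apply: dl => //; rewrite -E.
  by apply/funext => s'; rewrite E.
have dy h s t : smooth h ->
    is_derive t (1 : R) (fun t => complex.Re (h (plane z e w s t)))
      (complex.Re (rderive h iv (plane z e w s t))).
  by move=> sh; exact: (dl h iv (line v (z, e) s) t sh (Ap s t)).
have iE u : A u -> rderive f iv u = 'i * rderive f v u.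
  by move=> Au; exact: (holomorphic_rderive w sf Au (fun k => f_holo k Au)).
have iiE u : A u -> rderive (rderive f iv) iv u = - rderive (rderive f v) v u.
  move=> Au.
  have e1 := rderive_eq (g := fun p => 'i * rderive f v p) oA iv iE (sv iv) Au.
  have e2 := rderiveZ 'i iv (sv v) Au.
  have e3 := rderive_comm oA v iv sf Au.
  have e4 := rderive_eq (g := fun p => 'i * rderive f v p) oA v iE (sv iv) Au.
  have e5 := rderiveZ 'i v (sv v) Au.
  have e6 := etrans e1 (etrans e2 (congr1 (fun a => 'i * a) (etrans e3 (etrans e4 e5)))).
  apply: etrans e6 _; move: (rderive _ _ _) => p.
  by rewrite mulrA -expr2 sqrCi mulN1r.
have P0 : plane z e w 0 0 = (z, e) by rewrite /plane !line0.
pose U s t := complex.Re (f (plane z e w s t)).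
pose Ux s t := complex.Re (rderive f v (plane z e w s t)).
pose Uy s t := complex.Re (rderive f iv (plane z e w s t)).
pose Uxx s t := complex.Re (rderive (rderive f v) v (plane z e w s t)).
pose Uyy s t := complex.Re (rderive (rderive f iv) iv (plane z e w s t)).
suff H : U x y <= U 0 0 by move: H; rewrite /U P0.
have cU : continuous (fun p : R * R => U p.1 p.2).
  move=> p.
  apply: (@continuous_comp _ _ _ (fun p : R * R => f (plane z e w p.1 p.2))
    (@complex.Re R : C -> R)); last exact: Re_continuous.
  apply: (@continuous_comp _ _ _ (fun p : R * R => plane z e w p.1 p.2) f).
    exact: plane_continuous.
  exact: (smooth_continuous sf).
have harm s t : Uxx s t + Uyy s t = 0.
  by rewrite /Uyy (iiE _ (Ap s t)) CReN subrr.
exact: (@harmonic_le_center R U Ux Uy Uxx Uyy M cU (fun s t => dx f s t sf)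
  (fun s t => dx (rderive f v) s t (sv v)) (fun s t => dy f s t sf)
  (fun s t => dy (rderive f iv) s t (sv iv)) harm HM x y).
Qed.

End FiberLiouville.

Section FiberConstant.
Variables (R : realType) (n : nat).
Local Notation C := (Cplx R).
Local Notation V := ('rV[C]_n * 'rV[C]_n)%type.
Variable A : set V.
Hypothesis oA : open A.
Hypothesis A_fiber : forall z e e', A (z, e) -> e' != 0 -> A (z, e').
Hypothesis A_slit : forall u, A u -> u.2 != 0.
Implicit Types (f : V -> C) (z e w : 'rV[C]_n) (x y : R).
Local Notation smooth := (smooth_on A).

Lemma holomorphic_degree0_const f z e e' : smooth f ->
  (forall k u, A u -> detabar k f u = 0) ->
  (forall lam, lam != 0 -> scales A lam 1 f) ->
  A (z, e) -> A (z, e') -> f (z, e) = f (z, e').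
Proof.
move=> sf f_holo f_deg Aze Aze'.
have e0 : e != 0 := A_slit Aze; have e'0 : e' != 0 := A_slit Aze'.
have [[c ce]|nc] := pselect (exists c : C, e + c *: (e' - e) = 0).
  have c0 : c != 0 by apply: contra_neq e0 => c0; rewrite -ce c0 scale0r addr0.
  (* From [e + c (e' - e) = 0] one gets [c e' = (c - 1) e]: the two points are proportional. *)
  pose l := c^-1 * (c - 1).
  have eE : e' = l *: e.
    apply: (scalerI c0); rewrite scalerA mulVKf// scalerBl scale1r.
    by apply/eqP; rewrite -subr_eq0 opprB addrCA -scalerBr ce.
  have l0 : l != 0 by apply: contra_neq e'0 => l0; rewrite eE l0 scale0r.
  have := f_deg l l0 (z, e) Aze; rewrite mul1r => <-.
  by rewrite /fiber_scale /= -eE.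
have ee0 c : e + c *: (e' - e) != 0 by apply/eqP => E; apply: nc; exists c.
have [<-//|ee'] := eqVneq e e'.
have d0 : e' - e != 0 by rewrite subr_eq0 eq_sym.
have ee0' c : e' + c *: (e - e') != 0.
  have := ee0 (1 - c); rewrite scalerBl scale1r (addrA e) (addrCA e e' (- e)).
  by rewrite subrr addr0 -scalerN opprB.
have d0' : e - e' != 0 by rewrite subr_eq0.
(* Each of [e] and [e'] serves once as the centre of [plane_Re_le], giving the two inequalities. *)
have E1 h : smooth h -> (forall k u, A u -> detabar k h u = 0) ->
    (forall lam, lam != 0 -> scales A lam 1 h) ->
    complex.Re (h (z, e)) = complex.Re (h (z, e')).
  move=> sh h_holo h_deg; apply/le_anti/andP; split.
    have := plane_Re_le oA A_fiber sh h_holo h_deg 1 0 Aze' d0' ee0'.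
    by rewrite planeE mul0r addr0 scale1r addrC subrK.
  have := plane_Re_le oA A_fiber sh h_holo h_deg 1 0 Aze d0 ee0.
  by rewrite planeE mul0r addr0 scale1r addrC subrK.
apply: Ceq; first exact: E1.
have [c cE] := Im_as_Re R; rewrite -!cE.
apply: (E1 (fun u => c * f u)) => [|k u Au|lam lam0 u Au].
- exact: smoothZ.
- have := derZ (S := smooth_on A) (@smooth_cst _ _ A oA)
    (wirtinger_bar_derivation oA (0, delta_mx 0 k)) c sf Au.
  by rewrite -/(detabar k _ u) => ->; rewrite -/(detabar k f u) f_holo// mulr0.
- by rewrite f_deg// !mul1r.
Qed.

End FiberConstant.

(** * The charts of a complex Finsler space *)

Section FiberwiseConstant.
Variables (R : realType) (n : nat).
Local Notation C := (Cplx R).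
Local Notation V := ('rV[C]_n * 'rV[C]_n)%type.
Variable A : set V.
Hypothesis oA : open A.
Implicit Types (f : V -> C) (x : V).

Lemma rderive_fiberwise_const f (w : 'rV[C]_n) x :
  (forall z e e', A (z, e) -> A (z, e') -> f (z, e) = f (z, e')) -> A x ->
  rderive f (0, w) x = 0.
Proof.
move=> fc Ax; apply: is_rderiveE; apply: (@is_rderive_quadratic _ _ _ _ _ _ 0).
near=> t; rewrite !mulr0 !addr0.
have At : A (line (0, w) x t) by near: t; exact: near_line.
have lE : line (0, w) x t = (x.1, x.2 + ((t%:C)%C : C) *: w).
  by rewrite /line; congr (_, _); rewrite /= scaler0 addr0.
rewrite lE in At *; rewrite [x in RHS]surjective_pairing; apply: fc => //.
by rewrite -surjective_pairing.
Unshelve. all: by end_near. Qed.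

Lemma deta_fiberwise_const f k x :
  (forall z e e', A (z, e) -> A (z, e') -> f (z, e) = f (z, e')) -> A x ->
  deta k f x = 0.
Proof.
move=> fc Ax; rewrite /deta /wirtinger.
have -> : 'i *: ((0, delta_mx 0 k) : V) = (0, 'i *: delta_mx 0 k).
  by congr (_, _); rewrite /= scaler0.
by rewrite !rderive_fiberwise_const// mulr0 subr0 mulr0.
Qed.

Lemma detabar_fiberwise_const f k x :
  (forall z e e', A (z, e) -> A (z, e') -> f (z, e) = f (z, e')) -> A x ->
  detabar k f x = 0.
Proof.
move=> fc Ax; rewrite /detabar /wirtinger_bar.
have -> : 'i *: ((0, delta_mx 0 k) : V) = (0, 'i *: delta_mx 0 k).
  by congr (_, _); rewrite /= scaler0.
by rewrite !rderive_fiberwise_const// mulr0 addr0 mulr0.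
Qed.

End FiberwiseConstant.

Section FinslerChart.
Variables (R : realType) (n : nat) (M : complexManifold R n).
Variables (F : complexFinsler M) (a : chart_index M).
Local Notation C := (Cplx R).
Local Notation V := ('rV[C]_n * 'rV[C]_n)%type.
Local Notation A := (@slit_tangent_dom R n M a).
Local Notation L := (finsler_L F a).
Local Notation smooth := (smooth_on A).

Lemma open_slit : open A.
Proof.
have -> : A = (fst @^-1` (chart a @` chart_dom a)) `&` (snd @^-1` (~` [set 0])).
  by apply/seteqP; split=> x [x1 /eqP x2]; split=> //; exact/eqP.
apply: openI.
  apply: open_comp; last exact: chart_image_open.
  by move=> x _; exact: cvg_fst.
apply: open_comp; first by move=> x _; exact: cvg_snd.
apply: closed_openC; apply: accessible_closed_set1; apply: hausdorff_accessible.
exact: norm_hausdorff.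
Qed.

Lemma slit_fiber z (e e' : 'rV[C]_n) : A (z, e) -> e' != 0 -> A (z, e').
Proof. by move=> [ze _] e'0; split. Qed.

Lemma slit_neq0 x : A x -> x.2 != 0.
Proof. by case. Qed.

Lemma slit_scale lam x : lam != 0 -> A x -> A (fiber_scale lam x).
Proof. by move=> lam0 [x1 x2]; split=> //=; rewrite scaler_eq0 negb_or lam0. Qed.

Lemma smooth_L : smooth L.
Proof. exact: finsler_smooth. Qed.

Lemma conj_L x : (L x)^* = L x.
Proof. by apply: Ceq; rewrite ?CReJ ?CImJ //= oppr0. Qed.

Lemma L_scales lam : scales A lam (lam * lam^*) L.
Proof.
move=> [z e] [ze _]; rewrite -normCK /finsler_L.
have sq (t : R) : ((t ^+ 2)%:C)%C = ((t%:C)%C : C) ^+ 2.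
  by rewrite !expr2; apply: Ceq; rewrite ?CReM ?CImM /=; ring.
by rewrite !sq (finsler_homogeneous F lam ze) exprMn.
Qed.

Lemma scales_eq lam c c' (f : V -> C) : c = c' -> scales A lam c f -> scales A lam c' f.
Proof. by move=> ->. Qed.

Lemma smooth_detabar k f : smooth f -> smooth (detabar k f).
Proof. exact: der_smooth (wirtinger_bar_derivation open_slit _) f. Qed.

Lemma smooth_deta k f : smooth f -> smooth (deta k f).
Proof. exact: der_smooth (wirtinger_derivation open_slit _) f. Qed.

Lemma smooth_dz k f : smooth f -> smooth (dz k f).
Proof. exact: der_smooth (wirtinger_derivation open_slit _) f. Qed.

Lemma smooth_metric i j : smooth (metric L i j).
Proof. by apply/smooth_deta/smooth_detabar/smooth_L. Qed.

(** [L] scales by [lam * lam^*]; [detabar] divides by the conjugate factor and leaves [lam]. *)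
Lemma degree_detabar_L j : degree A 1 (detabar j L).
Proof.
move=> lam lam0; apply: scales_eq (detabar_scales open_slit slit_scale j lam0
  (L_scales lam) smooth_L).
by rewrite mulrCA mulVf ?mulr1 ?expr1// conjC_eq0.
Qed.

Lemma degree_metric i j : degree A 0 (metric L i j).
Proof.
move=> lam lam0; apply: scales_eq (deta_scales open_slit slit_scale i lam0
  (degree_detabar_L j lam0) (smooth_detabar j smooth_L)).
by rewrite expr1 mulVf.
Qed.

Lemma degree0E f lam x : degree A 0 f -> lam != 0 -> A x ->
  f (fiber_scale lam x) = f x.
Proof. by move=> fd lam0 Ax; rewrite fd// mul1r. Qed.

Lemma metric_mx_scale lam x : lam != 0 -> A x ->
  metric_mx L (fiber_scale lam x) = metric_mx L x.
Proof.
move=> lam0 Ax; rewrite /metric_mx; apply: eq_mx => i j.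
have E := degree0E (degree_metric i j) lam0 Ax.
exact E.
Qed.

Lemma degree_dz_metric k i j : degree A 0 (dz k (metric L i j)).
Proof.
move=> lam lam0.
exact: (@dz_scales _ _ _ open_slit _ _ _ k (@degree_metric i j lam lam0)
  (smooth_metric i j)).
Qed.

Lemma fiber_scale_coord lam (x : V) (i : 'I_n) :
  (fiber_scale lam x).2 0 i = lam * x.2 0 i.
Proof. by rewrite /= mxE. Qed.

Lemma degree_cfN i j : degree A 1 (cfN L i j).
Proof.
have E (c d l e : C) : c * d * (l * e) = l ^+ 1 * (c * d * e).
  by rewrite expr1; ring.
move=> lam lam0 x Ax; rewrite /cfN mulr_sumr; apply: eq_bigr => m _.
rewrite mulr_sumr; apply: eq_bigr => l _.
rewrite fiber_scale_coord /metric_inv (metric_mx_scale lam0 Ax).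
rewrite (degree0E (degree_dz_metric j l m) lam0 Ax).
exact: E.
Qed.

Lemma degree_spray i : degree A 2 (spray L i).
Proof.
have E (c l d e : C) : c * d * (l * e) = l * c * (d * e) by ring.
move=> lam lam0 x Ax; rewrite /spray mulrCA; congr (_ * _); rewrite mulr_sumr.
apply: eq_bigr => j _; rewrite fiber_scale_coord (degree_cfN i j lam0 Ax).
by rewrite E expr1 expr2.
Qed.

(** A nonzero vector in the left kernel would make the positive definite form vanish. *)
Lemma metric_mx_unit x : A x -> metric_mx L x \in unitmx.
Proof.
move=> Ax; rewrite -row_free_unit -kermx_eq0; apply/negPn/negP.
move=> /rowV0Pn[v /sub_kermxP vG v0].
have := finsler_pos_def F Ax v0; rewrite exchange_big big1 ?ltxx// => j _.
have /matrixP/(_ 0 j) := vG; rewrite !mxE => E.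
rewrite -mulr_suml -[X in _ = X](mul0r (v 0 j)^*) -[in RHS]E; congr (_ * _).
by apply: eq_bigr => i _; rewrite mxE mulrC.
Qed.

Lemma smooth_metric_inv i j : smooth (metric_inv L i j).
Proof. exact: (smooth_invmx open_slit smooth_metric metric_mx_unit). Qed.

Lemma smooth_coord (i : 'I_n) : smooth (fun x : V => x.2 0 i).
Proof.
apply: (smooth_linear open_slit) => [x|x y|t v]; last 2 first.
- by rewrite /= mxE.
- by rewrite /= mxE.
apply: (@continuous_comp _ _ _ (@snd 'rV[C]_n 'rV[C]_n)
  (fun e : 'rV[C]_n => e 0 i)); first exact: cvg_snd.
exact: coord_continuous.
Qed.

Lemma smooth_cfN i j : smooth (cfN L i j).
Proof.
apply: (smooth_sum open_slit) => m; apply: (smooth_sum open_slit) => l.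
apply: (smoothM open_slit); last exact: smooth_coord.
by apply: (smoothM open_slit); [exact: smooth_metric_inv|exact/smooth_dz/smooth_metric].
Qed.

Lemma smooth_spray i : smooth (spray L i).
Proof.
apply: (smoothM open_slit); first exact: smooth_cst open_slit _.
apply: (smooth_sum open_slit) => j.
by apply: (smoothM open_slit); [exact: smooth_cfN|exact: smooth_coord].
Qed.

Lemma coordD (i : 'I_n) (x y : V) : (x + y).2 0 i = x.2 0 i + y.2 0 i.
Proof. by rewrite /= mxE. Qed.

Lemma coordZ (i : 'I_n) (c : C) (x : V) : (c *: x).2 0 i = c * x.2 0 i.
Proof. by rewrite /= mxE. Qed.

Definition is_wirtinger (D : (V -> C) -> V -> C) :=
  (exists v, D = wirtinger v) \/ (exists v, D = wirtinger_bar v).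

Lemma chart_setting : spray_setting A smooth is_wirtinger
  (fun i (x : V) => x.2 0 i) (@dz R n) (@dzbar R n) (@deta R n) (@detabar R n) L.
Proof.
have oA := open_slit.
split.
- exact: smooth_cst.
- exact: smoothD.
- exact: smoothM.
- exact: smoothJ.
- exact: smooth_eq.
- move=> D [] [v ->]; first exact: wirtinger_derivation.
  exact: wirtinger_bar_derivation.
- move=> D E f x [] [v ->] [] [w ->] sf Ax.
  + exact: (wirtinger_comm oA v w sf Ax).
  + exact: (wirtinger_wirtinger_bar_comm oA v w sf Ax).
  + exact: (esym (wirtinger_wirtinger_bar_comm oA w v sf Ax)).
  + exact: (wirtinger_bar_comm oA v w sf Ax).
- by move=> k; left; exists (delta_mx 0 k, 0).
- by move=> k; right; exists (delta_mx 0 k, 0).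
- by move=> k; left; exists (0, delta_mx 0 k).
- by move=> k; right; exists (0, delta_mx 0 k).
- exact: smooth_coord.
- move=> k l x _; rewrite /dz wirtinger_linear ?mxE//; [exact: coordD|exact: coordZ].
- move=> k l x _; rewrite /deta wirtinger_linear; [|exact: coordD|exact: coordZ].
  by rewrite mxE eqxx eq_sym.
- move=> k l x _; rewrite /detabar wirtinger_bar_linear//; [exact: coordD|exact: coordZ].
- by move=> k f x sf Ax; exact: conj_wirtinger sf Ax.
- by move=> k f x sf Ax; exact: conj_wirtinger sf Ax.
- by move=> k f x sf Ax; exact: conj_wirtinger_bar sf Ax.
- exact: smooth_L.
- by move=> x _; exact: conj_L.
- exact: metric_mx_unit.
- exact: smooth_metric_inv.
- move=> j x Ax.
  have := euler oA slit_neq0 (p := 1) isT (degree_detabar_L j)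
    (smooth_detabar j smooth_L) Ax.
  by rewrite mul1r.
- move=> i j x Ax.
  have := euler oA slit_neq0 (p := 0) isT (degree_metric i j) (smooth_metric i j) Ax.
  by rewrite mul0r.
- move=> i j x Ax.
  exact: (euler_bar oA slit_neq0 (p := 0) isT (degree_metric i j)
    (smooth_metric i j) Ax).
- move=> i x Ax.
  exact: (euler oA slit_neq0 (p := 2) isT (degree_spray i) (smooth_spray i) Ax).
- move=> i x Ax.
  exact: (euler_bar oA slit_neq0 (p := 2) isT (degree_spray i) (smooth_spray i) Ax).
Qed.

(** At the Wirtinger derivatives of the chart, the abstract tensors are convertible to the concrete
    ones, so the abstract result applies as it is. *)
Lemma chart_landsberg_iff :
  (forall x, A x -> forall l r h,
     \sum_k hcov3 L (cartan L) l r h k x * x.2 0 k = 0) <->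
  (forall x, A x -> forall i j k, berwald L i j k x = rund L i j k x).
Proof. exact: landsberg_iff chart_setting. Qed.

Lemma chart_spray_holomorphic_iff :
  (forall x, A x -> forall j h, \sum_r \sum_k
     hbarcov3 L (cartan L) j r h k x * (x.2 0 r)^* * (x.2 0 k)^* = 0) <->
  (forall x, A x -> forall i h, detabar h (spray L i) x = 0).
Proof. exact: spray_holomorphic_iff chart_setting. Qed.

Lemma chart_hcov2_metric_iff :
  (forall x, A x -> forall i h, detabar h (spray L i) x = 0) ->
  (forall x, A x -> forall i j k,
     hcov2 L (metric L) i j k x = \sum_m (rund_bar L m j k x)^* * metric L i m x) <->
  (forall x, A x -> forall i j k, berwald L i j k x = rund L i j k x).
Proof. exact: hcov2_metric_iff chart_setting. Qed.

Lemma chart_berwald_fiberwise_const :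
  (forall x, A x -> forall i h, detabar h (spray L i) x = 0) ->
  forall i j k z e e', A (z, e) -> A (z, e') ->
  berwald L i j k (z, e) = berwald L i j k (z, e').
Proof.
move=> hol i j k z e e' Ae Ae'.
have scN : smooth (cN L i j) by apply/smooth_deta/smooth_spray.
(* Each fibre derivative lowers the degree by one, from 2 for the spray to 0 for the Berwald
   coefficients, as Liouville's theorem requires. *)
have dcN : degree A 1 (cN L i j).
  move=> lam lam0; apply: scales_eq (deta_scales open_slit slit_scale j lam0
    (degree_spray i lam0) (smooth_spray i)).
  by rewrite expr2 mulKf// expr1.
have dB lam : lam != 0 -> scales A lam 1 (berwald L i j k).
  move=> lam0.
  apply: scales_eq (deta_scales open_slit slit_scale k lam0 (dcN lam lam0) scN).
  by rewrite expr1 mulVf.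
exact: (holomorphic_degree0_const open_slit slit_fiber slit_neq0 (smooth_deta k scN)
  (fun h u Au => deb_tB_eq0 chart_setting hol Au i j k h) dB Ae Ae').
Qed.

Lemma chart_spray_holomorphic :
  (forall i j k z e e', A (z, e) -> A (z, e') ->
     berwald L i j k (z, e) = berwald L i j k (z, e')) ->
  forall x, A x -> forall i h, detabar h (spray L i) x = 0.
Proof.
move=> Bc; apply: (spray_holomorphic_of_berwald chart_setting) => x Ax i j k h.
exact: (detabar_fiberwise_const open_slit h (Bc i j k) Ax).
Qed.

Lemma chart_cartan_skew :
  (forall x, A x -> forall i j k, berwald L i j k x = rund L i j k x) ->
  (forall x, A x -> forall i h, detabar h (spray L i) x = 0) ->
  forall x, A x ->
  (forall j r h k,
     hcov3 L (cartan L) j r h k x + hcov3 L (cartan L) k r h j x = 0) /\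
  (forall r l h k,
     hbarcov3 L (cartan L) r l h k x + hbarcov3 L (cartan L) r k h l x = 0).
Proof.
move=> lands hol x Ax; split; last first.
  exact: (hbarcov3_cartan_skew chart_setting lands hol Ax).
apply: (hcov3_cartan_skew chart_setting lands hol _ Ax) => u Au i j k h.
exact: (deta_fiberwise_const open_slit h (chart_berwald_fiberwise_const hol i j k) Au).
Qed.

Lemma chart_cartan_contracted :
  (forall x, A x ->
   (forall j r h k,
      hcov3 L (cartan L) j r h k x + hcov3 L (cartan L) k r h j x = 0) /\
   (forall r l h k,
      hbarcov3 L (cartan L) r l h k x + hbarcov3 L (cartan L) r k h l x = 0)) ->
  (forall x, A x -> forall l r h,
     \sum_k hcov3 L (cartan L) l r h k x * x.2 0 k = 0) /\
  (forall x, A x -> forall j h, \sum_r \sum_k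
     hbarcov3 L (cartan L) j r h k x * (x.2 0 r)^* * (x.2 0 k)^* = 0).
Proof.
move=> skew; split.
  exact: (hcov3_contracted_of_skew chart_setting (fun x Ax => (skew x Ax).1)).
exact: (hbarcov3_contracted_of_skew (fun x Ax => (skew x Ax).2)).
Qed.

End FinslerChart.

Theorem theorem3p2 (R : realType) (n : nat) (M : complexManifold R n)
    (F : complexFinsler M) :
  [<->
    (* i *)
    G_landsberg F ;
    (* ii *)
    complex_landsberg F /\ berwald_depends_only_on_z F ;
    (* iii *)
    (forall a x, slit_tangent_dom a x ->
      (forall l r h,
        \sum_k hcov3 (finsler_L F a) (cartan (finsler_L F a)) l r h k x
               * x.2 0 k = 0) /\
      (forall j h,
        \sum_r \sum_k
          hbarcov3 (finsler_L F a) (cartan (finsler_L F a)) j r h k x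
          * (x.2 0 r)^* * (x.2 0 k)^* = 0)) ;
    (* iv *)
    (forall a x, slit_tangent_dom a x ->
      (forall i j k,
        hcov2 (finsler_L F a) (metric (finsler_L F a)) i j k x
        = \sum_m (rund_bar (finsler_L F a) m j k x)^*
                 * metric (finsler_L F a) i m x) /\
      (forall i h, detabar h (spray (finsler_L F a) i) x = 0)) ;
    (* v *)
    (forall a x, slit_tangent_dom a x ->
      (forall j r h k,
        hcov3 (finsler_L F a) (cartan (finsler_L F a)) j r h k x
        + hcov3 (finsler_L F a) (cartan (finsler_L F a)) k r h j x = 0) /\
      (forall r l h k,
        hbarcov3 (finsler_L F a) (cartan (finsler_L F a)) r l h k x
        + hbarcov3 (finsler_L F a) (cartan (finsler_L F a)) r k h l x = 0))
  ].
Proof.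
(* Every condition is quantified over the charts, so each implication of the cycle is obtained in a
   fixed chart. *)
tfae.
- move=> [lands hol]; split; first exact: lands.
  move=> a z e e' Ae Ae' i j k.
  exact: (chart_berwald_fiberwise_const (hol a) i j k Ae Ae').
- move=> [lands Bz] a x Ax; split.
    exact: ((chart_landsberg_iff F a).2 (lands a) x Ax).
  apply: ((chart_spray_holomorphic_iff F a).2 _ x Ax).
  apply: chart_spray_holomorphic => i j k z e e' Ae Ae'; exact: (Bz a z e e' Ae Ae').
- move=> H a.
  have hol := (chart_spray_holomorphic_iff F a).1 (fun x Ax => (H a x Ax).2).
  have lands := (chart_landsberg_iff F a).1 (fun x Ax => (H a x Ax).1).
  move=> x Ax; split; last exact: hol.
  exact: ((chart_hcov2_metric_iff hol).2 lands x Ax).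
- move=> H a; have hol x (Ax : slit_tangent_dom a x) := (H a x Ax).2.
  have lands := (chart_hcov2_metric_iff hol).1 (fun x Ax => (H a x Ax).1).
  exact: (chart_cartan_skew lands hol).
- move=> H; split=> a.
    exact: ((chart_landsberg_iff F a).1 (chart_cartan_contracted (H a)).1).
  exact: ((chart_spray_holomorphic_iff F a).1 (chart_cartan_contracted (H a)).2).
Qed.
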